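(* Let $(X,d,\mu)$, $p$, $\underline{Q}_\mu$ be as in the context, let $\theta\in(0,\underline{Q}_\mu)$ and let $S\in\mathcal{ADR}_\theta(X)$. Let $s>0$ and $p\in(1,\infty)$. Then a function $f\in L_p(\mathcal H_\theta\lfloor_S)$ belongs to $\mathrm B^s_p(S)$ if and only if $$\widetilde{\mathcal{BN}}^s_p(f):=\Big(\sum_{k=1}^\infty2^{ksp}\int_S\frac{1}{\mathcal H_\theta(B_k(x)\cap S)}\int_{B_k(x)\cap S}|f(x)-f(y)|^p\,d\mathcal H_\theta(y)\,d\mathcal H_\theta(x)\Big)^{1/p}<+\infty.$$ Furthermore, there is a constant $C>0$ such that $$\frac1C\|f|\mathrm B^s_p(S)\|\le\|f|L_p(\mathcal H_\theta\lfloor_S)\|+\widetilde{\mathcal{BN}}^s_p(f)\le C\|f|\mathrm B^s_p(S)\|\quad\text{for all }f\in L_p(\mathcal H_\theta\lfloor_S).$$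
   Context: Standing setting: $(X,d)$ complete separable metric space, $\mu$ a Borel regular locally finite outer measure, $\operatorname{supp}\mu=X$, uniformly locally doubling (for every $R>0$, $\sup_{r\in(0,R]}\sup_x\mu(B_{2r}(x))/\mu(B_r(x))<\infty$). Balls are closed, $B_r(x)=\{y:d(x,y)\le r\}$, $B_k(x)=B_{2^{-k}}(x)$. A fixed $p\in(1,\infty)$; $X$ supports a weak local $(1,p)$-Poincaré inequality (for every $R>0$ there are $C,\lambda\ge1$ with $\inf_c\frac{1}{\mu(B_r(x))}\int_{B_r(x)}|f-c|d\mu\le Cr(\frac{1}{\mu(B_{\lambda r}(x))}\int_{B_{\lambda r}(x)}(\operatorname{lip}f)^pd\mu)^{1/p}$ for Lipschitz $f$, $x\in X$, $r\in(0,R]$). $\underline{Q}_\mu$ is the infimum of $Q>0$ such that for every $R>0$ there is $C$ with $(r_{B'}/r_B)^Q\le C\mu(B')/\mu(B)$ for balls $B'\subset B$, $0<r_{B'}\le r_B\le R$. Notation: $\mathcal E_{\mathfrak m}(g,G):=\inf_{c\in\mathbb R}\mathfrak m(G)^{-1}\int_G|g-c|d\mathfrak m$ if $\mathfrak m(G)>0$, $0$ otherwise; $\mathfrak m\lfloor_S(E)=\mathfrak m(E\cap S)$. $\mathcal H_{\theta,\delta}(E):=\inf\{\sum\mu(B_{r_i}(x_i))r_i^{-\theta}:E\subset\bigcup B_{r_i}(x_i),0<r_i<\delta\}$ (countable covers), $\mathcal H_\theta=\lim_{\delta\to0}\mathcal H_{\theta,\delta}$. $S\in\mathcal{ADR}_\theta(X)$: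 $S$ closed and there are $\varkappa_1,\varkappa_2>0$ with $\varkappa_1\mu(B_r(x))r^{-\theta}\le\mathcal H_\theta(B_r(x)\cap S)\le\varkappa_2\mu(B_r(x))r^{-\theta}$ for all $x\in S$, $r\in(0,1]$. Besov space: $\|f|\mathrm B^s_p(S)\|:=\|f|L_p(\mathcal H_\theta\lfloor_S)\|+\big(\sum_{k\ge1}2^{ksp}\int_S(\mathcal E_{\mathcal H_\theta\lfloor_S}(f,B_k(x)))^pd\mathcal H_\theta(x)\big)^{1/p}$, and $\mathrm B^s_p(S)$ is the set of $f\in L_p(\mathcal H_\theta\lfloor_S)$ for which this is finite. *)

(* Defs.v *)
From HB Require Import structures.
From mathcomp Require Import all_boot all_order all_algebra.
From mathcomp Require Import all_classical all_reals all_analysis.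
Set Implicit Arguments. Unset Strict Implicit. Unset Printing Implicit Defensive.
Import Order.TTheory GRing.Theory Num.Theory.
Local Open Scope classical_set_scope.
Local Open Scope ring_scope.
Local Open Scope ereal_scope.

Section cover_ext.
Context (R : realType) (T I : Type) (adm : I -> Prop) (b : I -> set T)
  (c : I -> \bar R).
Hypothesis c_ge0 : forall i, 0 <= c i.

Definition ocset (o : option I) : set T := if o is Some i then b i else set0.
Definition occost (o : option I) : \bar R := if o is Some i then c i else 0.
Definition oadm (o : option I) : Prop := if o is Some i then adm i else True.

Definition covers (E : set T) : set (nat -> option I) :=
  [set F | (forall k, oadm (F k)) /\ E `<=` \bigcup_k ocset (F k)].

Definition cover_ext (E : set T) : \bar R :=
  ereal_inf [set \sum_(k <oo) occost (F k) | F in covers E].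

Let occost_ge0 o : 0 <= occost o. Proof. by case: o => //=. Qed.

Lemma cover_ext_ge0 E : 0 <= cover_ext E.
Proof.
apply: le_ereal_inf_tmp => x [F _ <-]; exact: nneseries_ge0.
Qed.

Lemma cover_ext0 : cover_ext set0 = 0.
Proof.
apply/eqP; rewrite eq_le cover_ext_ge0 andbT.
apply: ereal_inf_lbound; exists (fun=> None); first by split.
by rewrite /= eseries0.
Qed.

Lemma le_cover_ext : {homo cover_ext : A B / A `<=` B >-> A <= B}.
Proof.
move=> A B AB; apply/ereal_inf_le_tmp => x [F [aF BF]] <-.
by exists F => //; split => //; apply: subset_trans AB BF.
Qed.

Lemma cover_ext_sigma_subadditive : sigma_subadditive cover_ext.
Proof.
move=> A; have [[i ioo]|] := pselect (exists i, cover_ext (A i) = +oo).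
  rewrite (eseries_pinfty _ _ ioo) ?leey// => n _.
  by rewrite -ltNye (lt_le_trans _ (cover_ext_ge0 _)).
rewrite -forallNE => Aoo.
suff add2e (e : {posnum R}) :
    cover_ext (\bigcup_n A n) <= \sum_(i <oo) cover_ext (A i) + e%:num%:E.
  by apply/lee_addgt0Pr => _/posnumP[].
rewrite (le_trans _ (epsilon_trick _ _ _))//; last first.
  by move=> n; exact: cover_ext_ge0.
pose P n (B : (option I)^nat) := covers (A n) B /\
  \sum_(k <oo) occost (B k) <= cover_ext (A n) + (e%:num / (2 ^ n.+1)%:R)%:E.
have [G PG] : {G : ((option I)^nat)^nat & forall n, P n (G n)}.
  apply: (@choice _ _ P) => n; rewrite /P /cover_ext.
  set S := (X in ereal_inf X); move infS : (ereal_inf S) => iS.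
  case: iS infS => [r Sr|Soo|Soo].
  - have en1 : (0 < e%:num / (2 ^ n.+1)%:R)%R by [].
    have /(lb_ereal_inf_adherent en1) : ereal_inf S \is a fin_num by rewrite Sr.
    move=> [x [B mB muBx] xS].
    by exists B; split => //; rewrite muBx -Sr; exact/ltW.
  - by have := Aoo n; rewrite /cover_ext Soo.
  - suff : lbound S 0 by move/le_ereal_inf_tmp; rewrite Soo.
    by move=> /= _ [B mB <-]; exact: nneseries_ge0.
have muG_ge0 x : 0 <= (occost \o uncurry G) x by exact: occost_ge0.
apply: (@le_trans _ _ (\esum_(i in setT) (occost \o uncurry G) i)).
  rewrite /cover_ext; apply: ereal_inf_lbound => /=.
  have /card_esym/ppcard_eqP[f] := card_nat2.
  exists (uncurry G \o f).
    split => [i|]; first by rewrite /=; case: (f i) => a b0 /=; exact: ((PG a).1.1 b0).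
    apply: (@subset_trans _  (\bigcup_n \bigcup_k ocset (G n k))) => [t [i _]|].
      by move=> /((PG i).1.2) -[j _ ?]; exists i => //; exists j.
    move=> t [i _ [j _ Bijt]]; exists (f^-1%FUN (i, j)) => //=.
    by rewrite invK ?inE.
  rewrite -(esum_pred_image (occost \o uncurry G) _ xpredT) ?[fun=> _]set_true//.
  by rewrite image_eq.
rewrite (_ : esum _ _ = \sum_(i <oo) \sum_(j <oo ) occost (G i j)); last first.
  pose J : nat -> set (nat * nat) := fun i => [set (i, j) | j in setT].
  rewrite (_ : setT = \bigcup_k J k); last first.
    by rewrite predeqE => -[a b0]; split => // _; exists a => //; exists b0.
  rewrite esum_bigcupT /=; last 2 first.
    - apply/trivIsetP => i j _ _ ij.
      rewrite predeqE => -[n m] /=; split => //= -[] [_] _ [<-{n} _].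
      by move=> [m' _] [] /esym/eqP; rewrite (negbTE ij).
    - by move=> /= [n m]; exact: occost_ge0.
  rewrite -(image_id [set: nat]) -fun_true esum_pred_image//; last first.
    by move=> n _; exact: esum_ge0.
  apply: eq_eseriesr => /= j _.
  rewrite -(esum_pred_image (occost \o uncurry G) (pair j) predT)//=; last first.
    by move=> ? ? _ _; exact: (@can_inj _ _ _ snd).
  by congr esum; rewrite predeqE => -[a b0]; split; move=> [i _ <-]; exists i.
apply: lee_lim.
- apply: is_cvg_nneseries => n *.
  by apply: nneseries_ge0 => m *; exact: (muG_ge0 (n, m)).
- by apply: is_cvg_nneseries => n *; apply: adde_ge0 => //; exact: cover_ext_ge0.
- by near=> n; apply: lee_sum => i _; exact: (PG i).2.
Unshelve. all: by end_near. Qed.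

End cover_ext.

(* An outer measure, restricted to its Caratheodory-measurable sets,   *)
(* as a measure (this is how integrals w.r.t. outer measures are read) *)
Section cmeas.
Context {R : realType} {T : pointedType} (om : {outer_measure set T -> \bar R}).

Definition cmeas : set (caratheodory_type om) -> \bar R := om.

Let cmeas0 : cmeas set0 = 0. Proof. exact: caratheodory_measure0. Qed.
Let cmeas_ge0 A : 0 <= cmeas A. Proof. exact: caratheodory_measure_ge0. Qed.
Let cmeas_ssa : semi_sigma_additive cmeas.
Proof. exact: caratheodory_measure_sigma_additive. Qed.

HB.instance Definition _ := isMeasure.Build _ _ _ cmeas cmeas0 cmeas_ge0 cmeas_ssa.
End cmeas.
Arguments cmeas {R T} om _.

Section metric_defs.
Context {R : realType} {X : Type} (d : X -> X -> R).
Local Open Scope ring_scope.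

Definition cball (x : X) (r : R) : set X := [set y | d x y <= r].

Definition is_metric : Prop :=
  [/\ forall x y, d x y = 0 <-> x = y,
      forall x y, d x y = d y x &
      forall x y z, d x z <= d x y + d y z].

Definition complete_metric : Prop :=
  forall u : nat -> X,
    (forall e, 0 < e -> exists N, forall m n, (N <= m)%N -> (N <= n)%N ->
       d (u m) (u n) < e) ->
    exists l, forall e, 0 < e -> exists N, forall n, (N <= n)%N -> d (u n) l < e.

Definition separable_metric : Prop :=
  exists D : set X, countable D /\
    forall x e, 0 < e -> exists2 y, D y & d x y < e.

Definition dopen (U : set X) : Prop :=
  forall x, U x -> exists2 r, 0 < r & [set y | d x y < r] `<=` U.

Definition dclosed (S : set X) : Prop := dopen (~` S).

Definition dborel (A : set X) : Prop := <<s dopen >> A.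

Definition Lipschitz (f : X -> R) : Prop :=
  exists L : R, forall x y, `|f x - f y| <= L * d x y.

Definition lip (f : X -> R) (x : X) : \bar R :=
  ereal_sup [set ereal_inf
     [set ((ereal_sup [set (`|f y - f x|)%:E | y in cball x r]) * (r^-1)%:E)%E
       | r in [set r | 0 < r < rho]]
    | rho in [set rho : R | 0 < rho]].

End metric_defs.

Definition Emean {R : realType} {dd} {T : measurableType dd}
  (m : {measure set T -> \bar R}) (g : T -> R) (G : set T) : \bar R :=
  if (0 < m G)%E then
    ereal_inf [set ((m G)^-1 * \int[m]_(y in G) (`|g y - c|)%:E)%E | c in [set: R]]
  else 0.

Section measure_hyps.
Context {R : realType} {X : pointedType} (d : X -> X -> R)
  (mu : {outer_measure set X -> \bar R}).
Local Open Scope ring_scope.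

Definition omeas := cmeas mu.

Definition borel_regular : Prop :=
  (forall A, dborel d A -> caratheodory_measurable mu A) /\
  (forall A : set X, exists B, [/\ dborel d B, A `<=` B & mu B = mu A]).

Definition locally_finite : Prop :=
  forall x, exists2 r, 0 < r & (mu (cball d x r) < +oo)%E.

Definition full_support : Prop :=
  forall U, dopen d U -> U !=set0 -> (0 < mu U)%E.

Definition unif_loc_doubling : Prop :=
  forall R0, 0 < R0 -> exists C : R, forall x r, 0 < r -> r <= R0 ->
    (mu (cball d x (2 * r)) <= C%:E * mu (cball d x r))%E.

Definition poincare (p : R) : Prop :=
  forall R0, 0 < R0 -> exists C lam : R, [/\ 1 <= C, 1 <= lam &
    forall f : X -> R, Lipschitz d f -> forall x r, 0 < r -> r <= R0 ->
      (Emean omeas f (cball d x r) <=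
        (C * r)%:E * poweR ((mu (cball d x (lam * r)))^-1 *
           \int[omeas]_(y in cball d x (lam * r)) poweR (lip d f y) p) p^-1)%E].

Definition Qadm (Q : R) : Prop :=
  0 < Q /\ forall R0, 0 < R0 -> exists C : R, forall x x' r r',
    0 < r' -> r' <= r -> r <= R0 -> cball d x' r' `<=` cball d x r ->
    (((r' / r) `^ Q)%:E <= C%:E * (mu (cball d x' r') * (mu (cball d x r))^-1))%E.

Definition Qlow : \bar R := ereal_inf [set Q%:E | Q in Qadm].

End measure_hyps.

Section Htheta.
Context {R : realType} {X : pointedType} (d : X -> X -> R)
  (mu : {outer_measure set X -> \bar R}) (theta : R).
Local Open Scope ring_scope.

Definition Hcost (xr : X * R) : \bar R :=
  (mu (cball d xr.1 xr.2) * (xr.2 `^ (- theta))%:E)%E.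

Lemma Hcost_ge0 xr : (0 <= Hcost xr)%E.
Proof. by apply: mule_ge0 => //; rewrite lee_fin powR_ge0. Qed.

(* H_{theta,delta}(E): inf over countable (finite or infinite) covers by
   balls B_{r_i}(x_i), 0 < r_i < delta; a cover is a sequence of optional
   (center, radius) pairs, None standing for "no ball". *)
Definition Hdelta (delta : R) : set X -> \bar R :=
  cover_ext (fun xr : X * R => 0 < xr.2 < delta)
            (fun xr => cball d xr.1 xr.2) Hcost.

(* H_theta = lim_{delta -> 0} H_{theta,delta} = sup_{delta > 0} (monotone) *)
Definition Hth (E : set X) : \bar R :=
  ereal_sup [set Hdelta delta E | delta in [set delta : R | 0 < delta]].

Let Hdelta_ge0 delta E : (0 <= Hdelta delta E)%E.
Proof. exact: cover_ext_ge0 Hcost_ge0 _. Qed.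

Lemma Hth0 : Hth set0 = 0%E.
Proof.
apply/eqP; rewrite eq_le; apply/andP; split.
  apply: ge_ereal_sup => _ [delta _ <-].
  by rewrite /Hdelta cover_ext0 //; exact: Hcost_ge0.
by apply: ereal_sup_ubound; exists 1 => //=; rewrite /Hdelta cover_ext0//; exact: Hcost_ge0.
Qed.

Lemma Hth_ge0 E : (0 <= Hth E)%E.
Proof.
apply: le_trans (Hdelta_ge0 1 E) _.
rewrite /Hth; apply: ereal_sup_ubound.
by exists 1%R => //=; rewrite ltr01.
Qed.

Lemma le_Hth : {homo Hth : A B / A `<=` B >-> (A <= B)%E}.
Proof.
move=> A B AB; apply: ge_ereal_sup => _ [delta d0 <-].
apply: le_trans (le_cover_ext _ _ _ AB) _.
by rewrite /Hth; apply: ereal_sup_ubound; exists delta.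
Qed.

Lemma Hth_sigma_subadditive : sigma_subadditive Hth.
Proof.
move=> A; apply: ge_ereal_sup => _ [delta d0 <-].
apply: le_trans (cover_ext_sigma_subadditive _ _ Hcost_ge0 _) _.
apply: lee_nneseries => n _; first by move=> _; exact: Hdelta_ge0.
by rewrite /Hth; apply: ereal_sup_ubound; exists delta.
Qed.

HB.instance Definition _ := isOuterMeasure.Build R X Hth
  Hth0 Hth_ge0 le_Hth Hth_sigma_subadditive.

Definition Hrestr (S : set X) (E : set X) : \bar R := Hth (E `&` S).

Lemma Hrestr_outer (S : set X) : isOuterMeasure R X (Hrestr S).
Proof.
split.
- by rewrite /Hrestr set0I Hth0.
- by move=> E; exact: Hth_ge0.
- by move=> A B AB; apply: le_Hth; exact: setSI.
- move=> F; rewrite /Hrestr setI_bigcupl; exact: Hth_sigma_subadditive.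
Qed.

HB.instance Definition _ (S : set X) := Hrestr_outer S.

Definition HSm (S : set X) := cmeas (Hrestr S : {outer_measure set X -> \bar R}).
Arguments HSm : clear implicits.

Definition ADR (S : set X) : Prop :=
  dclosed d S /\ exists k1 k2 : R, [/\ 0 < k1, 0 < k2 &
    forall x r, S x -> 0 < r <= 1 ->
      (k1%:E * (mu (cball d x r) * (r `^ (- theta))%:E) <= Hth (cball d x r `&` S)
       /\ Hth (cball d x r `&` S) <= k2%:E * (mu (cball d x r) * (r `^ (- theta))%:E))%E].

Definition Lp_mem (S : set X) (p : R) (f : X -> R) : Prop :=
  measurable_fun [set: caratheodory_type (Hrestr S)] f /\
  ('N[HSm S]_(p%:E)[EFin \o f] < +oo)%E.

Definition Lp_norm (S : set X) (p : R) (f : X -> R) : \bar R :=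
  'N[HSm S]_(p%:E)[EFin \o f].

Definition besov_norm (S : set X) (s p : R) (f : X -> R) : \bar R :=
  (Lp_norm S p f +
   poweR (\sum_(1 <= k <oo) ((2 `^ (k%:R * s * p))%:E *
      \int[HSm S]_(x in S) poweR (Emean (HSm S) f (cball d x (2 ^- k))) p)) p^-1)%E.

Definition in_Besov (S : set X) (s p : R) (f : X -> R) : Prop :=
  Lp_mem S p f /\ (besov_norm S s p f < +oo)%E.

Definition BNt (S : set X) (s p : R) (f : X -> R) : \bar R :=
  poweR (\sum_(1 <= k <oo) ((2 `^ (k%:R * s * p))%:E *
      \int[HSm S]_(x in S) ((Hth (cball d x (2 ^- k) `&` S))^-1 *
         \int[HSm S]_(y in cball d x (2 ^- k) `&` S)
             (`|f x - f y| `^ p)%:E)))%E p^-1.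

End Htheta.

(* Main.v *)
Require Import Defs.
From HB Require Import structures.
From mathcomp Require Import all_boot all_order all_algebra.
From mathcomp Require Import all_classical all_reals all_analysis.
From mathcomp Require Import measurable_realfun.
From mathcomp Require Import ring lra.
Set Implicit Arguments. Unset Strict Implicit. Unset Printing Implicit Defensive.
Import Order.TTheory GRing.Theory Num.Theory.
Import numFieldNormedType.Exports.
Local Open Scope classical_set_scope.
Local Open Scope ring_scope.

(** Write [m] for the restriction of H_theta to [S] and [f_k(x)] for the
    [m]-average of [f] over [B_k(x)].  Ahlfors regularity makes [m] doubling on
    balls centred in [S], so for [y] in [B_(k+1)(x)]
    [|f_(k+1)(y) - f_k(x)| <= C E(f, B_k(x))].  Jensen's inequality, with the
    constant [c = f(x)], bounds [E(f, B_k(x))^p] by the average of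
    [|f(x) - f(y)|^p]: this is one half of the equivalence.

    For the other half, put [a_k = int_S |f_n - f_k|^p].  Convexity of [t^p]
    with weights [2^-s] and [1 - 2^-s] gives
    [2^(ksp) a_k <= 2^-s 2^((k+1)sp) a_(k+1) + C 2^(ksp) int_S E(f, B_k)^p],
    and [a_n = 0], so summing backwards from [n] bounds [sum 2^(ksp) a_k]
    uniformly in [n].  Letting [n] tend to infinity requires [f_n -> f] in
    [L_p(m)]: this holds for indicators of bounded closed sets by continuity of
    [m] from above and Fubini, then for indicators of Borel sets (a
    lambda-system), of all measurable sets (H_theta is Borel regular, being
    built from closed balls), and finally for all of [L_p].  Fubini and the
    measurability of balls rest on H_theta being a metric outer measure. *)

(** * Double integrals *)

(** The bound on the [a_k] concerns [f - f_k] only, not yet [f(x) - f(y)]. For [d x y <= 2^-(k+1)]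
    the difference is split as [(f(x) - f_k(x)) + (f_k(x) - f_(k+1)(y)) + (f_(k+1)(y) - f(y))]. The
    outer terms are of the first kind and the middle one is at most [C E(f, B_k(x))]. The scales
    differ by one because the smaller ball about [y] has to fit into the larger ball about [x]. The
    coarsest scale therefore has no predecessor and is charged to [||f||_p^p], which is why the L_p
    norm enters the upper estimate. The detour through [f_n], with [a_n = 0], is forced: the sums
    with [f] in place of [f_n] may a priori be infinite, so a multiple of them cannot be absorbed
    into the left-hand side. The analysis is carried out for an abstract kernel [k_n(x, y)] of mass
    one in [y], comparable under exchange of [x] and [y] and between consecutive scales. The
    convergence [f_n -> f] is proved in the stronger form [int int k_n(x, y) |f(x) - f(y)|^p -> 0].
    This is stable under sums and L_p limits and can be computed for an indicator. *)

Section powR_ineq.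
Context {R : realType}.
Implicit Types (a b c t p : R).

(** Convexity of [z^p] at the points [a / t] and [b / (1 - t)], with weights [t] and [1 - t].
    Keeping [t] free matters: for [t = 2^-s] the factor [t^(1 - p)] is just what the passage from
    one scale to the next can afford. *)
Lemma powR_add_le t p a b : 0 < t < 1 -> 1 <= p -> 0 <= a -> 0 <= b ->
  (a + b) `^ p <= t `^ (1 - p) * a `^ p + (1 - t) `^ (1 - p) * b `^ p.
Proof.
move=> /andP[t0 t1] p1 a0 b0.
have u0 : 0 < 1 - t by rewrite subr_gt0.
have scaleX (u z : R) : 0 < u -> 0 <= z -> u * (z / u) `^ p = u `^ (1 - p) * z `^ p.
  move=> ugt0 z0; rewrite powRM ?invr_ge0 ?(ltW ugt0)//.
  rewrite -powR_inv1 ?(ltW ugt0)// -powRrM mulN1r mulrCA mulrC; congr (_ * _).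
  by rewrite -{1}(powRr1 (ltW ugt0)) -powRD// ?(gt_eqF ugt0) ?implybT.
rewrite -(scaleX t a)// -(scaleX (1 - t) b)//.
have t01 : 0 <= t <= 1 by rewrite !ltW.
have := @convex_powR R p p1 (Itv01 (ltW t0) (ltW t1)) (a / t) (b / (1 - t)).
have at0 : 0 <= a / t by rewrite divr_ge0// ltW.
have bt0 : 0 <= b / (1 - t) by rewrite divr_ge0// ltW.
rewrite !inE/= !in_itv/= !andbT => /(_ at0 bt0).
rewrite !convRE/= /unstable.onem.
move=> cvx; apply: le_trans cvx; rewrite le_eqVlt; apply/orP; left.
apply/eqP; congr (_ `^ _).
transitivity (t * (a / t) + (1 - t) * (b / (1 - t))) => //.
by rewrite mulrC divfK ?gt_eqF// mulrC divfK ?gt_eqF.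
Qed.

Lemma powR_add2_le p a b : 1 <= p -> 0 <= a -> 0 <= b ->
  (a + b) `^ p <= 2 `^ (p - 1) * (a `^ p + b `^ p).
Proof.
move=> p1 a0 b0; have t01 : 0 < (2^-1 : R) < 1 by lra.
apply: le_trans (powR_add_le t01 p1 a0 b0) _.
have -> : 1 - 2^-1 = 2^-1 :> R by lra.
have -> : (2^-1 : R) `^ (1 - p) = 2 `^ (p - 1).
  by rewrite -powR_inv1// -powRrM mulN1r opprB.
by rewrite mulrDr.
Qed.

Lemma powR_norm_add2_le p a b : 1 <= p ->
  `|a + b| `^ p <= 2 `^ (p - 1) * (`|a| `^ p + `|b| `^ p).
Proof.
move=> p1; apply: le_trans (powR_add2_le p1 (normr_ge0 _) (normr_ge0 _)).
by rewrite ge0_ler_powR ?nnegrE ?addr_ge0 ?ler_normD// (le_trans ler01).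
Qed.

End powR_ineq.

(* No measurability is required: the integral of a non-negative function is a
   supremum over the simple functions below it. *)
Lemma ge0_le_integralW d (T : measurableType d) (R : realType)
    (m : {measure set T -> \bar R}) (D : set T) (f g : T -> \bar R) :
  (forall x, D x -> 0 <= f x)%E -> (forall x, D x -> f x <= g x)%E ->
  (\int[m]_(x in D) f x <= \int[m]_(x in D) g x)%E.
Proof.
move=> f0 fg.
have g0 x : D x -> (0 <= g x)%E by move=> Dx; exact: le_trans (f0 _ Dx) (fg _ Dx).
rewrite !ge0_integralE//; apply: ereal_sup_le => _ [h hf <-].
exists h => //= x; apply: le_trans (hf x) _.
by rewrite /patch; case: ifPn => // /set_mem /fg.
Qed.

Section double_integral.
Context (dT : measure_display) (T : measurableType dT) (R : realType).
Implicit Types (F G : T -> T -> R) (g : T -> R).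

Definition jmeas F := measurable_fun [set: T * T] (fun z => F z.1 z.2).

Lemma jmeasC F : jmeas F -> jmeas (fun x y => F y x).
Proof.
by move=> mF; exact: (measurableT_comp mF (measurable_swap (T1:=T) (T2:=T))).
Qed.

Lemma jmeas_fst g : measurable_fun setT g -> jmeas (fun x _ => g x).
Proof. by move=> mg; apply: measurableT_comp => //; exact: measurable_fst. Qed.

Lemma jmeas_snd g : measurable_fun setT g -> jmeas (fun _ y => g y).
Proof. by move=> mg; apply: measurableT_comp => //; exact: measurable_snd. Qed.

Lemma jmeasM F G : jmeas F -> jmeas G -> jmeas (fun x y => F x y * G x y).
Proof. by move=> mF mG; exact: measurable_funM. Qed.

Lemma jmeasD F G : jmeas F -> jmeas G -> jmeas (fun x y => F x y + G x y).
Proof. by move=> mF mG; exact: measurable_funD. Qed.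

Lemma jmeasB F G : jmeas F -> jmeas G -> jmeas (fun x y => F x y - G x y).
Proof. by move=> mF mG; exact: measurable_funB. Qed.

Lemma measurable_norm_powR d' (T' : measurableType d') (f : T' -> R) (p : R) :
  measurable_fun setT f -> measurable_fun setT (fun x => `|f x| `^ p).
Proof.
move=> mf; apply: (measurableT_comp (measurable_powR _)).
exact: measurableT_comp.
Qed.

Lemma jmeas_norm_powR F p : jmeas F -> jmeas (fun x y => `|F x y| `^ p).
Proof. by move=> mF; exact: measurable_norm_powR. Qed.

Lemma jmeas_sec F x : jmeas F -> measurable_fun setT (F x).
Proof. by move=> mF; exact: (measurable_fun_pair2 x mF). Qed.

Lemma jmeas_secE F x : jmeas F -> measurable_fun setT (fun y => (F x y)%:E).
Proof. by move=> mF; exact/measurable_EFinP/jmeas_sec. Qed.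

Context (m : {sigma_finite_measure set T -> \bar R}).

Definition dint F : \bar R := (\int[m]_x \int[m]_y (F x y)%:E)%E.

Lemma jmeas_int F : jmeas F -> (forall x y, 0 <= F x y) ->
  measurable_fun setT (fun x => \int[m]_y (F x y)%:E)%E.
Proof.
move=> mF F0; apply: (@measurable_fun_fubini_tonelli_F _ _ _ _ _ m
  (fun z : T * T => (F z.1 z.2)%:E)); first exact/measurable_EFinP.
by move=> z; rewrite lee_fin.
Qed.

Lemma dint_ge0 F : (forall x y, 0 <= F x y) -> (0 <= dint F)%E.
Proof. by move=> F0; apply: integral_ge0 => x _; apply: integral_ge0 => y _; rewrite lee_fin. Qed.

Lemma le_dint F G : (forall x y, 0 <= F x y) -> (forall x y, F x y <= G x y) ->
  (dint F <= dint G)%E.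
Proof.
move=> F0 FG; apply: ge0_le_integralW => x _.
  by apply: integral_ge0 => y _; rewrite lee_fin.
by apply: ge0_le_integralW => y _; rewrite lee_fin.
Qed.

Lemma dintC F : jmeas F -> (forall x y, 0 <= F x y) ->
  dint F = dint (fun x y => F y x).
Proof.
move=> mF F0; apply: (@fubini_tonelli _ _ _ _ _ m m (fun z : T * T => (F z.1 z.2)%:E)).
  exact/measurable_EFinP.
by move=> z; rewrite lee_fin.
Qed.

Lemma dintD F G : jmeas F -> jmeas G -> (forall x y, 0 <= F x y) ->
  (forall x y, 0 <= G x y) ->
  dint (fun x y => F x y + G x y) = (dint F + dint G)%E.
Proof.
move=> mF mG F0 G0; rewrite /dint.
have int0 (H : T -> T -> R) x : (forall x y, 0 <= H x y) ->
    (0 <= \int[m]_y (H x y)%:E)%E.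
  by move=> H0; apply: integral_ge0 => y _; rewrite lee_fin.
rewrite -ge0_integralD//; [|by move=> x _; exact: int0|exact: jmeas_int
  |by move=> x _; exact: int0|exact: jmeas_int].
apply: eq_integral => x _.
under eq_integral do rewrite EFinD.
by rewrite ge0_integralD//; try (by move=> y _; rewrite lee_fin); exact: jmeas_secE.
Qed.

Lemma dintZ F c : jmeas F -> (forall x y, 0 <= F x y) -> 0 <= c ->
  dint (fun x y => c * F x y) = (c%:E * dint F)%E.
Proof.
move=> mF F0 c0; rewrite /dint -ge0_integralZl//; last 2 first.
- exact: jmeas_int.
- by move=> x _; apply: integral_ge0 => y _; rewrite lee_fin.
apply: eq_integral => x _; under eq_integral do rewrite EFinM.
by rewrite ge0_integralZl//; [exact: jmeas_secE|move=> y _; rewrite lee_fin].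
Qed.

End double_integral.

(** * Averaging kernels *)

(** The extra multiple of [b 0] makes the induction close: [1 + rho / (1 - rho) = (1 - rho)^-1], and
    one use of the recursion turns [(1 - rho)^-1 * b 0] into [rho / (1 - rho) * b 1], the extra term
    of the shifted sequence. Nothing is subtracted, so infinite values do no harm. *)
Lemma backward_sum_le (R : realType) (rho : R) (b u : nat -> \bar R) n :
  0 < rho < 1 -> (forall i, 0 <= b i)%E -> (forall i, 0 <= u i)%E ->
  (forall i, (i < n)%N -> b i <= rho%:E * b i.+1 + u i)%E -> b n = 0%E ->
  (\sum_(0 <= i < n) b i + (rho / (1 - rho))%:E * b 0%N
   <= ((1 - rho)^-1)%:E * \sum_(0 <= i < n) u i)%E.
Proof.
move=> /andP[r0 r1]; have r10 : 0 < 1 - rho by rewrite subr_gt0.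
set l := rho / (1 - rho); set L := (1 - rho)^-1.
have l0 : 0 <= l by rewrite divr_ge0 // ltW.
have L0 : 0 <= L by rewrite invr_ge0 ltW.
have Ll : L = 1 + l by rewrite /L /l; field; rewrite gt_eqF.
elim: n b u => [|n IH] b u b0 u0 H bn.
  by rewrite !big_geq// bn !mule0 adde0.
rewrite !big_nat_recl//= addeAC.
have -> : (b 0%N + l%:E * b 0%N = L%:E * b 0%N)%E.
  by rewrite Ll EFinD ge0_muleDl ?lee_fin// mul1e.
have su0 : (0 <= \sum_(0 <= i < n) u i.+1)%E by exact: sume_ge0.
rewrite ge0_muleDr//.
have IHn := IH (fun i => b i.+1) (fun i => u i.+1)
  (fun i => b0 i.+1) (fun i => u0 i.+1) (fun i ni => H i.+1 ni) bn.
apply: (@le_trans _ _ (L%:E * (rho%:E * b 1%N + u 0%N) + \sum_(0 <= i < n) b i.+1)%E).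
  by apply: leeD => //; apply: lee_wpmul2l; [rewrite lee_fin|exact: H].
rewrite ge0_muleDr// ?mule_ge0 ?lee_fin ?(ltW r0)// muleA -EFinM [L * rho]mulrC.
by rewrite addeAC addeC; apply: leeD => //; rewrite addeC.
Qed.

(** The bound on the sums of [a] is asked for every length, since the shifted terms [a i.+1] reach
    index [n]. *)
Lemma lee_sum_shift (R : realType) (c1 c2 c3 c : R) (a u : nat -> \bar R) (U : \bar R) n :
  0 <= c1 -> 0 <= c2 -> 0 <= c3 -> 0 <= c -> (0 <= U)%E ->
  (forall i, 0 <= a i)%E -> (forall i, 0 <= u i)%E ->
  (forall N, \sum_(0 <= i < N) a i <= c%:E * U)%E ->
  (\sum_(0 <= i < n) u i <= U)%E ->
  (\sum_(0 <= i < n) (c1%:E * a i + (c2%:E * u i + c3%:E * a i.+1))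
   <= (c1 * c + (c2 + c3 * c))%:E * U)%E.
Proof.
move=> c10 c20 c30 c0 U0 a0 u0 aU uU.
have distr (b : R) (v : nat -> \bar R) : (forall i, 0 <= v i)%E ->
    (\sum_(0 <= i < n) (b%:E * v i) = b%:E * \sum_(0 <= i < n) v i)%E.
  by move=> v0; rewrite ge0_sume_distrr.
rewrite !big_split/= !distr//.
rewrite EFinD ge0_muleDl ?lee_fin ?addr_ge0 ?mulr_ge0//.
rewrite [X in (_ <= _ + X * _)%E]EFinD ge0_muleDl ?lee_fin ?mulr_ge0//.
apply: leeD; last apply: leeD.
- by rewrite EFinM -muleA; apply: lee_wpmul2l; rewrite ?lee_fin.
- by apply: lee_wpmul2l; rewrite ?lee_fin.
- rewrite EFinM -[leRHS]muleA; apply: lee_wpmul2l; first by rewrite lee_fin.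
  by apply: le_trans (aU n.+1); rewrite [leRHS]big_nat_recl//= leeDr.
Qed.

Section averaging_kernel.
Context (dT : measure_display) (T : measurableType dT) (R : realType)
  (m : {sigma_finite_measure set T -> \bar R}).
Implicit Types (f g : T -> R) (x y z : T) (n : nat).

(** What the argument uses of the kernel [1_(d x y <= r_n) / m(B(x, r_n))], freed from the metric.
    [ker_swap] replaces symmetry. [ker_step] expresses that the ball about [y] at scale [n.+1] lies
    in the ball of comparable mass about [x] at scale [n], and [ker_diag] allows [y = x] there.
    [ker_bnd] serves integrability only, so its bound may depend on [n] and [x]. *)
Record avg_kernel (S : set T) (k : nat -> T -> T -> R) (C : R) : Prop := AvgKernel {
  ker_C1 : 1 <= C ;
  ker_dom : measurable S ;
  ker_ge0 : forall n x y, 0 <= k n x y ;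
  ker_meas : forall n, jmeas (k n) ;
  ker_out : forall n x y, ~ S x -> k n x y = 0 ;
  ker_int : forall n x, S x -> (\int[m]_y (k n x y)%:E)%E = 1%E ;
  ker_bnd : forall n x, exists M, forall y, k n x y <= M ;
  ker_diag : forall n x, S x -> k n x x != 0 ;
  ker_swap : forall n x y, k n x y <= C * k n y x ;
  ker_step : forall n x y z, k n.+1 x y != 0 -> k n.+1 y z <= C * k n x z }.

Context (S : set T) (k : nat -> T -> T -> R) (C : R) (kP : avg_kernel S k C).
Let mS := ker_dom kP.
Let k0 := ker_ge0 kP.
Let mk := ker_meas kP.
Let C1 := ker_C1 kP.
Let C0 : 0 <= C. Proof. exact: le_trans C1. Qed.

Lemma ker_out2 n x y : ~ S y -> k n x y = 0.
Proof.
move=> Sy; apply/eqP; rewrite eq_le k0 andbT.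
by rewrite (le_trans (ker_swap kP n x y))// (ker_out kP) ?mulr0.
Qed.

Lemma ker_neq0 n x y : k n x y != 0 -> S x /\ S y.
Proof.
move=> kxy; split; apply: contrapT => Sx; move/eqP: kxy; apply.
  exact: ker_out kP _ _ _ Sx.
exact: ker_out2.
Qed.

Lemma ker_avg_fst n g : measurable_fun setT g -> (forall x, 0 <= g x) ->
  dint m (fun x y => k n x y * g x) = (\int[m]_(x in S) (g x)%:E)%E.
Proof.
move=> mg g0; rewrite [RHS]integral_mkcond; apply: eq_integral => x _.
rewrite patchE; case: ifPn => [/set_mem Sx|/negP Sx].
  under eq_integral do rewrite mulrC EFinM.
  rewrite ge0_integralZl//; [|exact: (jmeas_secE _ (mk n))|by move=> y _; rewrite lee_fin|by rewrite lee_fin].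
  by rewrite (ker_int kP)// mule1.
apply: integral0_eq => y _; rewrite (ker_out kP) ?mul0r//.
by move=> Sx'; apply: Sx; exact/mem_set.
Qed.

(** The mass is one in the second variable only; [ker_swap] and Tonelli exchange the variables at
    the price of the factor [C]. *)
Lemma ker_avg_snd n g : measurable_fun setT g -> (forall x, 0 <= g x) ->
  (dint m (fun x y => k n x y * g y)%R <= C%:E * \int[m]_(x in S) (g x)%:E)%E.
Proof.
move=> mg g0.
have mkg : jmeas (fun x y => k n x y * g x) by apply: jmeasM; [exact: mk|exact: jmeas_fst].
have kg0 x y : 0 <= k n x y * g x by exact: mulr_ge0.
apply: (@le_trans _ _ (dint m (fun x y => C * (k n y x * g y)))).
  apply: le_dint => x y; first exact: mulr_ge0.
  by rewrite mulrA ler_wpM2r// (ker_swap kP).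
rewrite dintZ//; last by exact: jmeasC mkg.
by rewrite -(ker_avg_fst n mg g0) (dintC m mkg).
Qed.

Section power.
Context (p : R) (p1 : 1 < p).
Let p0 : 0 < p. Proof. exact: lt_trans p1. Qed.
Let p1W : 1 <= p. Proof. exact: ltW. Qed.
Let D2 : R := 2 `^ (p - 1).
Let D20 : 0 <= D2. Proof. exact: powR_ge0. Qed.

Definition pint f : \bar R := (\int[m]_(x in S) (`|f x| `^ p)%:E)%E.

(** For the ball kernel, the double integral of the difference seminorm at [k = n + 1], before
    weighting ([diff_sumE]). *)
Definition kosc n f : \bar R := dint m (fun x y => k n x y * `|f x - f y| `^ p).

Lemma jmeas_kosc n f : measurable_fun setT f ->
  jmeas (fun x y => k n x y * `|f x - f y| `^ p).
Proof.
move=> mf; apply: jmeasM; [exact: mk|apply: jmeas_norm_powR].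
by apply: jmeasB; [exact: jmeas_fst|exact: jmeas_snd].
Qed.

Let kosc0 n f x y : 0 <= k n x y * `|f x - f y| `^ p.
Proof. by rewrite mulr_ge0 ?powR_ge0. Qed.

Lemma kosc_ge0 n f : (0 <= kosc n f)%E.
Proof. exact: dint_ge0. Qed.

Lemma pint_ge0 f : (0 <= pint f)%E.
Proof. by apply: integral_ge0 => x _; rewrite lee_fin powR_ge0. Qed.

Lemma kosc_add n f g : measurable_fun setT f -> measurable_fun setT g ->
  (kosc n (f \+ g)%R <= D2%:E * (kosc n f + kosc n g))%E.
Proof.
move=> mf mg; have [mF mG] := (jmeas_kosc n mf, jmeas_kosc n mg).
rewrite -(dintD m mF mG (kosc0 n f) (kosc0 n g)).
rewrite -(dintZ m (jmeasD mF mG) (fun x y => addr_ge0 (kosc0 n f x y) (kosc0 n g x y)) D20).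
apply: le_dint => // x y; rewrite -mulrDr mulrCA ler_wpM2l//=.
by rewrite opprD addrACA powR_norm_add2_le.
Qed.

Lemma kosc_scale n f c : measurable_fun setT f ->
  kosc n (fun x => c * f x) = ((`|c| `^ p)%:E * kosc n f)%E.
Proof.
move=> mf; rewrite -(dintZ m (jmeas_kosc n mf) (kosc0 n f) (powR_ge0 _ _)).
congr dint; apply/funext => x; apply/funext => y.
by rewrite -mulrBr normrM powRM// mulrCA.
Qed.

(** The constant does not depend on [n]. Hence vanishing of [kosc n f] passes to L_p limits in [f],
    and the coarsest scale is controlled by the L_p norm. *)
Lemma kosc_le_pint n f : measurable_fun setT f ->
  (kosc n f <= (D2 * (1 + C))%:E * pint f)%E.
Proof.
move=> mf; have mfp := measurable_norm_powR p mf.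
have fp0 x : 0 <= `|f x| `^ p by exact: powR_ge0.
apply: (@le_trans _ _ (dint m (fun x y =>
    D2 * (k n x y * `|f x| `^ p + k n x y * `|f y| `^ p)))).
  apply: le_dint => // x y; rewrite -mulrDr mulrCA ler_wpM2l//.
  by rewrite -(normrN (f y)) powR_norm_add2_le.
have mk1 : jmeas (fun x y => k n x y * `|f x| `^ p) by apply: jmeasM; [exact: mk|exact: jmeas_fst].
have mk2 : jmeas (fun x y => k n x y * `|f y| `^ p) by apply: jmeasM; [exact: mk|exact: jmeas_snd].
have k10 x y : 0 <= k n x y * `|f x| `^ p by exact: mulr_ge0.
have k20 x y : 0 <= k n x y * `|f y| `^ p by exact: mulr_ge0.
rewrite dintZ//; [|exact: jmeasD|by move=> x y; rewrite addr_ge0].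
rewrite dintD// EFinM -muleA; apply: lee_wpmul2l; rewrite ?lee_fin//.
rewrite EFinD ge0_muleDl ?lee_fin// mul1e ker_avg_fst//.
by apply: leeD => //; exact: ker_avg_snd.
Qed.

(** With [M] a bound of [k n x], one has [k |f| <= k + M |f|^p] on [S]: the first term covers
    [|f| <= 1], the second [|f| > 1], and both are integrable. *)
Lemma ker_integrable n x f : measurable_fun setT f -> (pint f < +oo)%E ->
  m.-integrable setT (fun y => (k n x y * f y)%:E).
Proof.
move=> mf foo.
have mkx : measurable_fun setT (k n x) by exact: jmeas_sec.
apply/integrableP; split; first by apply/measurable_EFinP/measurable_funM.
have [Sx|Sx] := pselect (S x); last first.
  rewrite (_ : integral _ _ _ = 0)%E//; apply: integral0_eq => y _.
  by rewrite (ker_out kP)// mul0r abse0.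
have [M kM] := ker_bnd kP n x.
have M0 : 0 <= M by apply: le_trans (kM x).
have mfp := measurable_norm_powR p mf.
have mfpS : measurable_fun setT (((fun y => (`|f y| `^ p)%:E) \_ S)%E).
  by apply/(measurable_restrictT _ mS)/measurable_EFinP; exact: measurable_funS mfp.
have fpS0 y : (0 <= ((fun y => (`|f y| `^ p)%:E) \_ S) y)%E.
  by rewrite patchE; case: ifPn; rewrite ?lee_fin ?powR_ge0.
apply: (@le_lt_trans _ _ (\int[m]_y ((k n x y)%:E +
    M%:E * ((fun y => (`|f y| `^ p)%:E) \_ S) y))%E).
  apply: ge0_le_integralW => y _ //; rewrite patchE.
  case: ifPn => [_|/negP Sy]; last first.
    rewrite ker_out2 ?mul0r ?abse0 ?mule0 ?adde0 ?lexx//.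
    by move=> Sy'; apply: Sy; exact/mem_set.
  rewrite abse_EFin -EFinM -EFinD lee_fin normrM ger0_norm//.
  have [f1|f1] := leP `|f y| 1.
    by rewrite -[leLHS]addr0 lerD ?mulr_ge0 ?powR_ge0// ler_piMr.
  rewrite -[leLHS]add0r lerD// ler_pM//.
  by rewrite -[leLHS]powRr1// ler_powR// ltW.
rewrite ge0_integralD//; last 4 first.
- by move=> y _; rewrite lee_fin.
- exact/measurable_EFinP.
- by move=> y _; rewrite mule_ge0 ?lee_fin.
- by apply: measurable_funeM.
rewrite (ker_int kP)// ge0_integralZl// -integral_mkcond.
by rewrite lte_add_pinfty ?ltry// lte_mul_pinfty ?lee_fin.
Qed.

Definition kavg n f x : R := fine (\int[m]_y (k n x y * f y)%:E)%E.

(** Positive and negative parts are integrated separately, because [jmeas_int] is Tonelli's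
    statement for non-negative integrands. *)
Lemma measurable_kavg n f : measurable_fun setT f -> measurable_fun setT (kavg n f).
Proof.
move=> mf; apply: (measurableT_comp (fine_measurable measurableT)) => //.
have mkf : jmeas (fun x y => k n x y * f y) by apply: jmeasM; [exact: mk|exact: jmeas_snd].
rewrite (_ : (fun x => _) = fun x =>
  \int[m]_y (Num.max (k n x y * f y) 0)%:E -
  \int[m]_y (Num.max (- (k n x y * f y)) 0)%:E)%E; last first.
  by apply/funext => x; rewrite integralE; congr (_ - _)%E; apply: eq_integral => y _;
     rewrite ?funeposE ?funenegE -?EFinN EFin_max.
apply: emeasurable_funB; apply: jmeas_int => [|x y]; rewrite ?le_max ?lexx ?orbT//.
  exact: measurable_maxr.
by apply: measurable_maxr => //; exact: measurableT_comp.
Qed.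

Lemma kavg_dist n f x c : measurable_fun setT f -> (pint f < +oo)%E -> S x ->
  ((`|kavg n f x - c|)%:E <= \int[m]_y (k n x y * `|f y - c|)%:E)%E.
Proof.
move=> mf foo Sx.
have kfi := ker_integrable n x mf foo.
have ki : m.-integrable setT (fun y => (k n x y)%:E).
  apply/integrableP; split; first exact: (jmeas_secE _ (mk n)).
  under eq_integral do rewrite gee0_abs ?lee_fin//.
  by rewrite (ker_int kP)// ltry.
have kcE : (\int[m]_y (k n x y * c)%:E = c%:E)%E.
  by under eq_integral do rewrite mulrC EFinM; rewrite integralZl// (ker_int kP)// mule1.
have kci : m.-integrable setT (fun y => (k n x y * c)%:E).
  apply: eq_integrable (integrableZl measurableT c ki) => // y _.
  by rewrite mulrC EFinM.
have -> : ((`|kavg n f x - c|)%:E = `|\int[m]_y (k n x y * (f y - c))%:E|)%E.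
  rewrite -abse_EFin EFinB /kavg fineK; last exact: integrable_fin_num.
  rewrite -{1}kcE -integralB_EFin//; congr (`| _ |)%E; apply: eq_integral => y _.
  by rewrite -EFinB mulrBr.
apply: le_trans (le_abse_integral _ _ _) _ => //.
  apply/measurable_EFinP/measurable_funM; first exact: jmeas_sec.
  exact: measurable_funB.
by apply: ge0_le_integralW => y _ //; rewrite abse_EFin normrM ger0_norm.
Qed.

(** For the ball kernel and [x] in [S] this is the mean oscillation over the ball of radius
    [2^-(n+1)] about [x] ([Emean_osc]). *)
Definition osc n f x : \bar R :=
  ereal_inf [set (\int[m]_y (k n x y * `|f y - c|)%:E)%E | c in [set: R]].

Lemma osc_ge0 n f x : (0 <= osc n f x)%E.
Proof.
apply: le_ereal_inf_tmp => _ [c _ <-].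
by apply: integral_ge0 => y _; rewrite lee_fin mulr_ge0.
Qed.

Let C10 : 0 < 1 + C. Proof. by rewrite ltr_wpDr. Qed.

(** Both averages are compared with the same [c]. The one at [x] costs [1] and the one at [y] costs
    [C] by [ker_step]. The factor [1 + C] stands inverted on the left so that the infimum over [c]
    is taken directly. *)
Lemma kavg_osc n f x y : measurable_fun setT f -> (pint f < +oo)%E ->
  k n.+1 x y != 0 ->
  (((1 + C)^-1 * `|kavg n.+1 f y - kavg n f x|)%:E <= osc n f x)%E.
Proof.
move=> mf foo kxy; have [Sx Sy] := ker_neq0 kxy.
apply: le_ereal_inf_tmp => _ [c _ <-].
set J := (X in (_ <= X)%E).
have J0 : (0 <= J)%E by apply: integral_ge0 => z _; rewrite lee_fin mulr_ge0.
have mfc : measurable_fun setT (fun z => `|f z - c|).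
  by apply: measurableT_comp => //; exact: measurable_funB.
have JC : (\int[m]_z (k n.+1 y z * `|f z - c|)%:E <= C%:E * J)%E.
  rewrite -ge0_integralZl//; last 2 first.
  - by apply/measurable_EFinP/measurable_funM => //; exact: jmeas_sec.
  - by move=> z _; rewrite lee_fin mulr_ge0.
  apply: ge0_le_integralW => z _; first by rewrite lee_fin mulr_ge0.
  by rewrite -EFinM lee_fin mulrA ler_wpM2r// (ker_step kP).
rewrite -(@lee_pmul2l _ (1 + C)%:E) ?lte_fin// -EFinM mulVKf ?gt_eqF//.
apply: (@le_trans _ _ ((`|kavg n f x - c|)%:E + (`|kavg n.+1 f y - c|)%:E)%E).
  rewrite -EFinD lee_fin [leRHS]addrC.
  have -> : kavg n.+1 f y - kavg n f x = (kavg n.+1 f y - c) - (kavg n f x - c) by ring.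
  exact: ler_normB.
rewrite EFinD ge0_muleDl ?lee_fin// mul1e; apply: leeD.
  exact: kavg_dist.
by apply: le_trans JC; exact: kavg_dist.
Qed.

Let K : R := (1 + C) `^ p.

Lemma kavg_osc_powR n f x y : measurable_fun setT f -> (pint f < +oo)%E ->
  k n.+1 x y != 0 ->
  ((K^-1 * `|kavg n.+1 f y - kavg n f x| `^ p)%:E <= poweR (osc n f x) p)%E.
Proof.
move=> mf foo kxy.
have -> : K^-1 = (1 + C)^-1 `^ p.
  by rewrite -[(1 + C)^-1]powR_inv1 ?(ltW C10)// -powRrM mulN1r powRN.
rewrite -powRM ?invr_ge0 ?(ltW C10)//.
rewrite -poweR_EFin; apply: gt0_ler_poweR; rewrite ?(ltW p0)//.
- by rewrite in_itv/= lee_fin mulr_ge0 ?invr_ge0 ?(ltW C10)//= leey.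
- by rewrite in_itv/= osc_ge0 leey.
- exact: kavg_osc.
Qed.

Definition oscp n f : \bar R := (\int[m]_(x in S) poweR (osc n f x) p)%E.

Lemma oscp_ge0 n f : (0 <= oscp n f)%E.
Proof. by apply: integral_ge0 => x _; exact: poweR_ge0. Qed.

Let K0 : 0 < K. Proof. exact: powR_gt0. Qed.

(** [kavg_osc_powR] on the diagonal [y = x], which [ker_diag] permits. *)
Lemma kavg_step_le n f : measurable_fun setT f -> (pint f < +oo)%E ->
  (pint (fun x => kavg n.+1 f x - kavg n f x)%R <= K%:E * oscp n f)%E.
Proof.
move=> mf foo; rewrite -lee_pdivrMl// -ge0_integralZl//; last 2 first.
- apply/measurable_EFinP/measurable_funTS/measurable_norm_powR.
  by apply: measurable_funB; exact: measurable_kavg.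
- by rewrite lee_fin invr_ge0 ltW.
apply: ge0_le_integralW => x Sx.
  by rewrite -EFinM lee_fin mulr_ge0 ?powR_ge0 ?invr_ge0 ?(ltW K0).
by rewrite -EFinM; apply: kavg_osc_powR => //; exact: ker_diag kP _ _ Sx.
Qed.

(** The pointwise bound by the oscillation at [x] is independent of [y], so integration against the
    kernel of mass one preserves it. *)
Lemma kavg_cross_le n f : measurable_fun setT f -> (pint f < +oo)%E ->
  (dint m (fun x y => k n.+1 x y * `|kavg n.+1 f y - kavg n f x| `^ p)%R
   <= K%:E * oscp n f)%E.
Proof.
move=> mf foo.
have mF : jmeas (fun x y => k n.+1 x y * `|kavg n.+1 f y - kavg n f x| `^ p).
  apply: jmeasM; [exact: mk|apply: jmeas_norm_powR].
  by apply: jmeasB; [apply: jmeas_snd|apply: jmeas_fst]; exact: measurable_kavg.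
rewrite -lee_pdivrMl// -dintZ//; last 2 first.
- by move=> x y; rewrite mulr_ge0 ?powR_ge0.
- by rewrite invr_ge0 ltW.
have KF0 x y : 0 <= K^-1 * (k n.+1 x y * `|kavg n.+1 f y - kavg n f x| `^ p).
  by rewrite !mulr_ge0 ?powR_ge0 ?invr_ge0 ?(ltW K0).
rewrite /oscp integral_mkcond; apply: ge0_le_integralW => x _.
  by apply: integral_ge0 => y _; rewrite lee_fin.
rewrite patchE; case: ifPn => [/set_mem Sx|/negP Sx]; last first.
  rewrite integral0_eq// => y _; rewrite (ker_out kP) ?mul0r ?mulr0//.
  by move=> Sx'; apply: Sx; exact/mem_set.
(* An infinite oscillation at [x] makes the inequality trivial; otherwise it is a real [r] that can
   be placed under the integral. *)
case E : (poweR (osc n f x) p) => [r||]; [|by rewrite leey|]; last first.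
  by have := poweR_ge0 (osc n f x) p; rewrite E.
have r0 : 0 <= r by rewrite -lee_fin -E poweR_ge0.
apply: (@le_trans _ _ (\int[m]_y (r * k n.+1 x y)%:E)%E).
  apply: ge0_le_integralW => y _; rewrite lee_fin// mulrCA [leRHS]mulrC.
  have [->|kxy] := eqVneq (k n.+1 x y) 0; first by rewrite !mul0r.
  by rewrite ler_wpM2l// -lee_fin -E kavg_osc_powR.
under eq_integral do rewrite EFinM.
rewrite ge0_integralZl//; [|exact: (jmeas_secE _ (mk n.+1))|by move=> y _; rewrite lee_fin].
by rewrite (ker_int kP)// mule1.
Qed.

(* Young's inequality [g a^(p-1) <= g^p / p + a^p / q], integrated against the
   kernel with [a] the average of [g]. *)
Lemma ker_jensen n x g : S x -> measurable_fun setT g -> (forall y, 0 <= g y) ->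
  (poweR (\int[m]_y (k n x y * g y)%:E) p <= \int[m]_y (k n x y * g y `^ p)%:E)%E.
Proof.
move=> Sx mg g0; set A := (X in poweR X p); set B := (X in (_ <= X)%E).
have mkx : measurable_fun setT (k n x) by exact: jmeas_sec (mk n).
have mgp : measurable_fun setT (fun y => g y `^ p).
  exact: measurableT_comp (measurable_powR _) mg.
have A0 : (0 <= A)%E by apply: integral_ge0 => y _; rewrite lee_fin mulr_ge0.
have B0 : (0 <= B)%E by apply: integral_ge0 => y _; rewrite lee_fin mulr_ge0 ?powR_ge0.
(* A pointwise inequality between [g] and [g^p], integrated against the probability [k n x]. It is
   used twice: with [g <= g^p + 1], to see that [A] is finite, and with Young's inequality. *)
have AB (u v w : R) : 0 <= u -> 0 <= v -> 0 <= w ->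
    (forall y, u * g y <= v * g y `^ p + w) -> (u%:E * A <= v%:E * B + w%:E)%E.
  move=> u0 v0 w0 H; rewrite -ge0_integralZl//; last 2 first.
  - exact/measurable_EFinP/measurable_funM.
  - by move=> y _; rewrite lee_fin mulr_ge0.
  apply: (@le_trans _ _ (\int[m]_y (v%:E * (k n x y * g y `^ p)%:E + w%:E * (k n x y)%:E))%E).
    apply: ge0_le_integralW => y _; first by rewrite -EFinM lee_fin !mulr_ge0.
    rewrite -!EFinM -EFinD lee_fin mulrCA (mulrCA v) (mulrC w) -mulrDr.
    by rewrite ler_wpM2l.
  rewrite ge0_integralD//; last 4 first.
  - by move=> y _; rewrite -EFinM lee_fin !mulr_ge0 ?powR_ge0.
  - exact/measurable_funeM/measurable_EFinP/measurable_funM.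
  - by move=> y _; rewrite -EFinM lee_fin !mulr_ge0.
  - exact/measurable_funeM/measurable_EFinP.
  rewrite !ge0_integralZl ?lee_fin//; last 4 first.
  - exact/measurable_EFinP.
  - by move=> y _; rewrite lee_fin.
  - exact/measurable_EFinP/measurable_funM.
  - by move=> y _; rewrite lee_fin mulr_ge0 ?powR_ge0.
  by rewrite (ker_int kP)// mule1.
have [Boo|Boo] := eqVneq B +oo%E; first by rewrite Boo leey.
have Bfin : B \is a fin_num by rewrite ge0_fin_numE// ltey.
have Afin : A \is a fin_num.
  rewrite ge0_fin_numE//.
  have := AB 1 1 1 ler01 ler01 ler01; rewrite !mul1e => /(_ _)/le_lt_trans; apply.
    move=> y; rewrite !mul1r.
    have [g1|g1] := leP (g y) 1; first by rewrite -[leLHS]add0r lerD// powR_ge0.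
    rewrite -[leLHS]addr0 lerD// -[leLHS]powRr1//.
    by rewrite ler_powR// ltW.
  by rewrite -(fineK Bfin) -EFinD ltry.
move: A0 B0 AB; rewrite -(fineK Afin) -(fineK Bfin) poweR_EFin !lee_fin.
move: (fine A) (fine B) => a b a0 b0 AB {A B Boo Bfin Afin}.
pose q := p / (p - 1).
have pm1 : 0 < p - 1 by rewrite subr_gt0.
have q0 : 0 < q by rewrite divr_gt0.
have pq : p^-1 + q^-1 = 1.
  by rewrite /q invf_div; field; rewrite gt_eqF.
have aq : (a `^ (p - 1)) `^ q = a `^ p by rewrite -powRrM /q mulrC divfK ?gt_eqF.
have aa : a `^ (p - 1) * a = a `^ p.
  rewrite -{2}(powRr1 a0) -powRD ?subrK//.
  by rewrite (gt_eqF p0).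
have := AB (a `^ (p - 1)) p^-1 (q^-1 * a `^ p).
rewrite -!EFinM -EFinD lee_fin aa => /(_ _ _ _ _).
have H1 : 0 <= p^-1 by rewrite invr_ge0 ltW.
have H2 : 0 <= q^-1 by rewrite invr_ge0 ltW.
rewrite powR_ge0 H1 mulr_ge0 ?powR_ge0// => /(_ isT isT isT).
have HY y : a `^ (p - 1) * g y <= p^-1 * g y `^ p + q^-1 * a `^ p.
  have := conjugate_powR (g0 y) (powR_ge0 a (p - 1)) p0 q0 pq.
  by rewrite aq mulrC (mulrC p^-1) (mulrC q^-1).
(* What is left is [a^p <= b / p + (1 - 1/p) a^p], where the finite [a^p] can be cancelled. *)
move=> /(_ HY); have -> : q^-1 = 1 - p^-1 by rewrite -pq addrC addKr.
rewrite mulrBl mul1r addrCA -subr_ge0 addrAC subrr add0r -mulrBr.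
by rewrite pmulr_rge0 ?invr_gt0// subr_ge0.
Qed.

Lemma osc_le_kosc n x f : S x -> measurable_fun setT f ->
  (poweR (osc n f x) p <= \int[m]_y (k n x y * `|f x - f y| `^ p)%:E)%E.
Proof.
move=> Sx mf.
have mfx : measurable_fun setT (fun y => `|f x - f y|).
  by apply: measurableT_comp => //; exact: measurable_funB.
apply: le_trans (ker_jensen n Sx mfx _) => //.
apply: gt0_ler_poweR; rewrite ?(ltW p0) ?in_itv/= ?leey ?andbT ?osc_ge0//.
  by apply: integral_ge0 => y _; rewrite lee_fin mulr_ge0.
apply: ereal_inf_lbound; exists (f x) => //.
by apply: eq_integral => y _; rewrite distrC.
Qed.

Lemma oscp_le_kosc n f : measurable_fun setT f -> (oscp n f <= kosc n f)%E.
Proof.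
move=> mf; rewrite /oscp integral_mkcond; apply: ge0_le_integralW => x _.
  by rewrite patchE; case: ifPn => // _; exact: poweR_ge0.
rewrite patchE; case: ifPn => [/set_mem Sx|_]; first exact: osc_le_kosc.
by apply: integral_ge0 => y _; rewrite lee_fin.
Qed.

(** Jensen's inequality after [kavg_dist] with [c = f x]. It turns vanishing of [kosc n f] into L_p
    convergence of the averages. *)
Lemma kavg_diff_le n f : measurable_fun setT f -> (pint f < +oo)%E ->
  (pint (fun x => f x - kavg n f x)%R <= kosc n f)%E.
Proof.
move=> mf foo; rewrite /pint integral_mkcond; apply: ge0_le_integralW => x _.
  by rewrite patchE; case: ifPn => // _; rewrite lee_fin powR_ge0.
rewrite patchE; case: ifPn => [/set_mem Sx|_]; last first.
  by apply: integral_ge0 => y _; rewrite lee_fin.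
have mfx : measurable_fun setT (fun y => `|f x - f y|).
  by apply: measurableT_comp => //; exact: measurable_funB.
apply: le_trans (ker_jensen n Sx mfx _) => //; rewrite -poweR_EFin.
apply: gt0_ler_poweR; rewrite ?(ltW p0) ?in_itv/= ?leey ?andbT ?lee_fin//.
  by apply: integral_ge0 => y _; rewrite lee_fin mulr_ge0.
rewrite distrC; apply: le_trans (kavg_dist n (f x) mf foo Sx) _.
by rewrite le_eqVlt; apply/orP; left; apply/eqP; apply: eq_integral => y _; rewrite distrC.
Qed.

(** The numerical inequality is a parameter because two versions are integrated: the sharp one with
    weights [t] and [1 - t], and the symmetric one with [2^(p - 1)]. *)
Lemma pint_add_le (a b : R) f g : 0 <= a -> 0 <= b ->
  measurable_fun setT f -> measurable_fun setT g ->
  (forall u v : R, `|u + v| `^ p <= a * `|u| `^ p + b * `|v| `^ p) ->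
  (pint (f \+ g)%R <= a%:E * pint f + b%:E * pint g)%E.
Proof.
move=> a0 b0 mf mg H.
have mfp : measurable_fun S (fun x => (`|f x| `^ p)%:E).
  exact/measurable_EFinP/measurable_funTS/measurable_norm_powR.
have mgp : measurable_fun S (fun x => (`|g x| `^ p)%:E).
  exact/measurable_EFinP/measurable_funTS/measurable_norm_powR.
rewrite -!ge0_integralZl ?lee_fin// -ge0_integralD//; last 4 first.
- by move=> x _; rewrite mule_ge0 ?lee_fin ?powR_ge0.
- exact: measurable_funeM.
- by move=> x _; rewrite mule_ge0 ?lee_fin ?powR_ge0.
- exact: measurable_funeM.
apply: ge0_le_integralW => x _; first by rewrite lee_fin powR_ge0.
by rewrite -!EFinM -EFinD lee_fin H.
Qed.

(** * Summation over the scales with weights [2^(ksp)] *)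

Section series.
Context (s : R) (s0 : 0 < s).
Let W n : R := 2 `^ (n.+1%:R * s * p).
Let t : R := 2 `^ (- s).
Let W0 n : 0 <= W n. Proof. exact: powR_ge0. Qed.
Let t01 : 0 < t < 1.
Proof.
rewrite powR_gt0//= /t powRN invf_lt1 ?powR_gt0//.
have : (1 : R) `^ s < 2 `^ s by rewrite gt0_ltr_powR ?nnegrE ?ler0n ?ler01 ?ltr1n.
by rewrite powR1.
Qed.
(** This identity dictates [t = 2^-s]: the loss [t^(1 - p)] from convexity, together with the weight
    of scale [n], is the weight of scale [n.+1] times the contraction factor [t < 1]. *)
Let Wt n : W n * t `^ (1 - p) = t * W n.+1.
Proof.
rewrite /t /W -powRrM -!powRD ?pnatr_eq0 ?implybT//; congr (_ `^ _).
by rewrite -(natr1 n.+1); ring.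
Qed.
Let Wq n : W n.+1 = 2 `^ (s * p) * W n.
Proof.
rewrite /W -powRD ?pnatr_eq0 ?implybT//; congr (_ `^ _).
by rewrite -(natr1 n.+1); ring.
Qed.
Let K1 : R := (1 - t) `^ (1 - p) * K.
Let K10 : 0 <= K1. Proof. by rewrite mulr_ge0 ?powR_ge0// ltW. Qed.

Lemma kavg_rec n i f : measurable_fun setT f -> (pint f < +oo)%E ->
  ((W i)%:E * pint (fun x => kavg n f x - kavg i f x)%R <=
   t%:E * ((W i.+1)%:E * pint (fun x => kavg n f x - kavg i.+1 f x)%R)
   + K1%:E * ((W i)%:E * oscp i f))%E.
Proof.
move=> mf foo.
rewrite muleA -EFinM -Wt EFinM -muleA (muleCA K1%:E) -ge0_muleDr; last 2 first.
- by rewrite mule_ge0 ?lee_fin ?powR_ge0 ?pint_ge0.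
- by rewrite mule_ge0 ?lee_fin ?oscp_ge0.
apply: lee_wpmul2l; rewrite ?lee_fin//.
have -> : (fun x => kavg n f x - kavg i f x) =
    (fun x => kavg n f x - kavg i.+1 f x) \+ (fun x => kavg i.+1 f x - kavg i f x).
  by apply/funext => x /=; ring.
apply: le_trans (pint_add_le (a := t `^ (1 - p)) (b := (1 - t) `^ (1 - p)) _ _ _ _ _) _;
  rewrite ?powR_ge0//.
- by apply: measurable_funB; exact: measurable_kavg.
- by apply: measurable_funB; exact: measurable_kavg.
- move=> u v; apply: le_trans (powR_add_le t01 p1W (normr_ge0 _) (normr_ge0 _)).
  by rewrite ge0_ler_powR ?nnegrE ?addr_ge0 ?ler_normD// ltW.
apply: leeD => //; rewrite /K1 EFinM -muleA; apply: lee_wpmul2l; rewrite ?lee_fin ?powR_ge0//.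
exact: kavg_step_le.
Qed.

Let U f : \bar R := (\sum_(0 <= i <oo) (W i)%:E * oscp i f)%E.
Let Wosc0 f i : (0 <= (W i)%:E * oscp i f)%E.
Proof. by rewrite mule_ge0 ?lee_fin ?oscp_ge0. Qed.

Let K2 : R := (1 - t)^-1 * K1.
Let t10 : 0 < 1 - t. Proof. by case/andP: t01; rewrite subr_gt0. Qed.
Let K20 : 0 <= K2. Proof. by rewrite mulr_ge0// invr_ge0 ltW. Qed.

Lemma kavg_sum_le n f : measurable_fun setT f -> (pint f < +oo)%E ->
  (\sum_(0 <= i < n) (W i)%:E * pint (fun x => kavg n f x - kavg i f x)%R
   <= K2%:E * U f)%E.
Proof.
move=> mf foo.
pose b i := ((W i)%:E * pint (fun x => kavg n f x - kavg i f x)%R)%E.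
pose u i := (K1%:E * ((W i)%:E * oscp i f))%E.
have b0 i : (0 <= b i)%E by rewrite mule_ge0 ?lee_fin ?pint_ge0.
have u0 i : (0 <= u i)%E by rewrite mule_ge0 ?lee_fin.
have bn : b n = 0%E.
  rewrite /b (_ : pint _ = 0%E) ?mule0//; apply: integral0_eq => x _.
  by rewrite subrr normr0 powR0 ?gt_eqF.
have := backward_sum_le t01 b0 u0 (fun i _ => kavg_rec n i mf foo) bn.
move=> H; apply: (@le_trans _ _ (((1 - t)^-1)%:E * \sum_(0 <= i < n) u i)%E).
  apply: le_trans H; rewrite leeDl// mule_ge0// lee_fin divr_ge0// ltW//.
  by case/andP: t01.
rewrite /K2 EFinM -muleA; apply: lee_wpmul2l; first by rewrite lee_fin invr_ge0 ltW.
rewrite -ge0_sume_distrr//; apply: lee_wpmul2l; rewrite ?lee_fin//.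
exact: nneseries_lim_ge.
Qed.

Let K3 : R := D2 * K2.
Let K30 : 0 <= K3. Proof. exact: mulr_ge0. Qed.

(** Stands in for [f_n -> f] in L_p. It does not mention averages and behaves well under linear
    combinations of [f]. *)
Definition kvanish f := forall e : R, 0 < e ->
  exists N, forall n, (N <= n)%N -> (kosc n f <= e%:E)%E.

(** The number [M] of terms is fixed before [n]. Replacing [f] by [f_n] in these terms costs a fixed
    multiple of [kosc n f], which is small for large [n], while [kavg_sum_le] is uniform in [n]. *)
Lemma kdiff_sum_le M f : measurable_fun setT f -> (pint f < +oo)%E -> kvanish f ->
  (\sum_(0 <= i < M) (W i)%:E * pint (fun x => f x - kavg i f x)%R <= K3%:E * U f)%E.
Proof.
move=> mf foo vf; apply/lee_addgt0Pr => e e0.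
pose w := \sum_(0 <= i < M) W i * D2.
have w0 : 0 <= w by apply: sumr_ge0 => i _; rewrite mulr_ge0.
(* The [+ 1] keeps the denominator positive when [M = 0]. *)
have [N Nf] := vf (e / (w + 1)) (divr_gt0 e0 (ltr_wpDl w0 ltr01)).
pose n := maxn M N.
apply: (@le_trans _ _ (D2%:E * \sum_(0 <= i < n) ((W i)%:E *
    pint (fun x => kavg n f x - kavg i f x)%R) + w%:E * kosc n f)%E); last first.
  apply: leeD.
    by rewrite /K3 EFinM -muleA; apply: lee_wpmul2l; [rewrite lee_fin|exact: kavg_sum_le].
  apply: (@le_trans _ _ (w%:E * (e / (w + 1))%:E)%E).
    by apply: lee_wpmul2l; rewrite ?lee_fin//; apply: Nf; exact: leq_maxr.
  rewrite -EFinM lee_fin mulrCA ler_piMr ?(ltW e0)//.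
  by rewrite ler_pdivrMr ?mul1r ?lerDl// ltr_wpDl.
have Wp i g : (0 <= (W i)%:E * pint g)%E by rewrite mule_ge0 ?lee_fin ?pint_ge0.
apply: (@le_trans _ _ (\sum_(0 <= i < M) (D2%:E * ((W i)%:E *
    pint (fun x => kavg n f x - kavg i f x)%R) + (W i * D2)%:E * kosc n f))%E).
  apply: lee_sum => i _.
  rewrite [(W i * D2)%R]mulrC EFinM -(muleA D2%:E) -ge0_muleDr ?Wp//; last first.
    by rewrite mule_ge0 ?lee_fin ?kosc_ge0.
  rewrite -ge0_muleDr ?pint_ge0 ?kosc_ge0// muleCA; apply: lee_wpmul2l; rewrite ?lee_fin//.
  have -> : (fun x => f x - kavg i f x) =
      (fun x => kavg n f x - kavg i f x) \+ (fun x => f x - kavg n f x).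
    by apply/funext => x /=; ring.
  apply: le_trans (pint_add_le (a := D2) (b := D2) _ _ _ _ _) _ => //.
  - by apply: measurable_funB; exact: measurable_kavg.
  - by apply: measurable_funB => //; exact: measurable_kavg.
  - by move=> u v; rewrite -mulrDr powR_norm_add2_le.
  rewrite -ge0_muleDr ?pint_ge0//; apply: lee_wpmul2l; rewrite ?lee_fin//.
  by apply: leeD => //; exact: kavg_diff_le.
rewrite big_split/=; apply: leeD.
  rewrite -ge0_sume_distrr//; apply: lee_wpmul2l; rewrite ?lee_fin//.
  rewrite (big_cat_nat (n := M) (p := n))//=; last exact: leq_maxl.
  by rewrite leeDl// sume_ge0.
by rewrite -ge0_sume_distrl ?sumEFin// => i _; rewrite lee_fin mulr_ge0.
Qed.

(** The three-term splitting of [f x - f y] through the average at scale [n] about [x] and the one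
    at scale [n.+1] about [y]. Two uses of the two-term inequality give [D2] for the first term and
    [D2 * D2] for the other two. *)
Lemma kosc_step_le n f : measurable_fun setT f -> (pint f < +oo)%E ->
  (kosc n.+1 f <= D2%:E * pint (fun x => f x - kavg n f x)%R
    + (D2 * D2)%:E * (K%:E * oscp n f + C%:E * pint (fun x => f x - kavg n.+1 f x)%R))%E.
Proof.
move=> mf foo.
pose g x : R := `|f x - kavg n f x| `^ p.
pose h x : R := `|f x - kavg n.+1 f x| `^ p.
have mg : measurable_fun setT g.
  by apply: measurable_norm_powR; apply: measurable_funB => //; exact: measurable_kavg.
have mh : measurable_fun setT h.
  by apply: measurable_norm_powR; apply: measurable_funB => //; exact: measurable_kavg.
pose F x y : R := k n.+1 x y * g x.
pose G x y : R := k n.+1 x y * `|kavg n.+1 f y - kavg n f x| `^ p.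
pose H x y : R := k n.+1 x y * h y.
have mF : jmeas F by apply: jmeasM; [exact: mk|exact: jmeas_fst].
have mH : jmeas H by apply: jmeasM; [exact: mk|exact: jmeas_snd].
have mG : jmeas G.
  apply: jmeasM; [exact: mk|apply: jmeas_norm_powR].
  by apply: jmeasB; [apply: jmeas_snd|apply: jmeas_fst]; exact: measurable_kavg.
have F0 x y : 0 <= F x y by rewrite mulr_ge0 ?powR_ge0.
have G0 x y : 0 <= G x y by rewrite mulr_ge0 ?powR_ge0.
have H0 x y : 0 <= H x y by rewrite mulr_ge0 ?powR_ge0.
have GH0 x y : 0 <= G x y + H x y := addr_ge0 (G0 x y) (H0 x y).
have mGH : jmeas (fun x y => G x y + H x y) by exact: jmeasD.
apply: (@le_trans _ _ (dint m (fun x y => D2 * F x y + (D2 * D2) * (G x y + H x y)))).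
  apply: le_dint => // x y; rewrite /F /G /H.
  rewrite -mulrDr mulrCA (mulrCA (D2 * D2)) -mulrDr ler_wpM2l//.
  have -> : f x - f y = (f x - kavg n f x) +
     ((- (kavg n.+1 f y - kavg n f x)) + (- (f y - kavg n.+1 f y))) by ring.
  apply: le_trans (powR_norm_add2_le _ _ p1W) _.
  rewrite -/D2 mulrDr lerD2l -mulrA ler_wpM2l// /h.
  apply: le_trans (powR_norm_add2_le _ _ p1W) _.
  by rewrite -/D2 !normrN.
have DD0 : 0 <= D2 * D2 by exact: mulr_ge0.
have mF' : jmeas (fun x y => D2 * F x y).
  by apply: jmeasM; [exact: measurable_cst|exact: mF].
have mGH' : jmeas (fun x y => (D2 * D2) * (G x y + H x y)).
  by apply: jmeasM; [exact: measurable_cst|exact: mGH].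
have F'0 x y : 0 <= D2 * F x y by exact: mulr_ge0.
have GH'0 x y : 0 <= (D2 * D2) * (G x y + H x y) by exact: mulr_ge0.
rewrite (dintD m mF' mGH' F'0 GH'0) (dintZ m mF F0 D20) (dintZ m mGH GH0 DD0).
rewrite (dintD m mG mH G0 H0); apply: leeD.
  by rewrite /F (ker_avg_fst _ mg)// => x; exact: powR_ge0.
apply: lee_wpmul2l; first by rewrite lee_fin.
apply: leeD; first exact: kavg_cross_le.
by apply: (ker_avg_snd _ mh) => x; exact: powR_ge0.
Qed.

Let q : R := 2 `^ (s * p).
Let K4 : R := q * D2 * K3 + (D2 * D2) * (q * K + C * K3).
Let q0 : 0 <= q. Proof. exact: powR_ge0. Qed.
Let KW0 : 0 <= K. Proof. exact: ltW. Qed.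

(** All scales but the coarsest. The factor [q = 2^(sp)] pays for bounding a term of weight [W i.+1]
    by quantities that live at scale [i]. *)
Lemma kosc_tail_le M f : measurable_fun setT f -> (pint f < +oo)%E -> kvanish f ->
  (\sum_(0 <= i < M) (W i.+1)%:E * kosc i.+1 f <= K4%:E * U f)%E.
Proof.
move=> mf foo vf.
pose a i := ((W i)%:E * pint (fun x => f x - kavg i f x)%R)%E.
have a0 i : (0 <= a i)%E by rewrite mule_ge0 ?lee_fin ?pint_ge0.
have DD0 : 0 <= D2 * D2 by rewrite mulr_ge0.
have U0 : (0 <= U f)%E by apply: nneseries_ge0 => i _ _; exact: Wosc0.
apply: (@le_trans _ _ (\sum_(0 <= i < M) ((q * D2)%:E * a i
    + ((D2 * D2 * (q * K))%:E * ((W i)%:E * oscp i f) + (D2 * D2 * C)%:E * a i.+1)))%E).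
  apply: lee_sum => i _.
  apply: (@le_trans _ _ ((W i.+1)%:E * _)%E).
    by apply: lee_wpmul2l; [rewrite lee_fin|exact: kosc_step_le].
  move: (pint_ge0 (fun x => f x - kavg i f x)) (pint_ge0 (fun x => f x - kavg i.+1 f x)).
  move: (oscp_ge0 i f); rewrite /a.
  move: (pint _) (pint _) (oscp i f) => A B O O0 A0 B0.
  rewrite ge0_muleDr; [|by rewrite mule_ge0 ?lee_fin|]; last first.
    by rewrite mule_ge0 ?lee_fin// adde_ge0 ?mule_ge0 ?lee_fin.
  apply: leeD; first by rewrite !muleA -!EFinM Wq -/q (mulrAC q).
  rewrite muleA -EFinM ge0_muleDr ?mule_ge0 ?lee_fin//.
  apply: leeD; rewrite !muleA -!EFinM.
    by rewrite Wq -/q (_ : q * W i * (D2 * D2) * K = D2 * D2 * (q * K) * W i)//; ring.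
  by rewrite (_ : W i.+1 * (D2 * D2) * C = D2 * D2 * C * W i.+1)//; ring.
have aM N : (\sum_(0 <= i < N) a i <= K3%:E * U f)%E by exact: kdiff_sum_le.
have -> : K4 = q * D2 * K3 + (D2 * D2 * (q * K) + D2 * D2 * C * K3) by rewrite /K4; ring.
apply: (@lee_sum_shift _ (q * D2) (D2 * D2 * (q * K)) (D2 * D2 * C) K3 a
  (fun i => (W i)%:E * oscp i f)%E (U f) M _ _ _ K30 U0 a0 (Wosc0 f) aM).
- exact: mulr_ge0.
- by rewrite mulr_ge0// mulr_ge0.
- exact: mulr_ge0.
- by apply: nneseries_lim_ge => i _ _; exact: Wosc0.
Qed.

(** The term [i = 0] has no coarser scale to be compared with; [kosc_le_pint] bounds it by
    [pint f]. *)
Lemma kosc_series_le : exists2 K' : R, 0 <= K' &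
  forall f, measurable_fun setT f -> (pint f < +oo)%E -> kvanish f ->
  (\sum_(0 <= i <oo) (2 `^ (i.+1%:R * s * p))%:E * kosc i f <=
   K'%:E * (pint f + \sum_(0 <= i <oo) (2 `^ (i.+1%:R * s * p))%:E * oscp i f))%E.
Proof.
have B0 : 0 <= W 0 * (D2 * (1 + C)) by rewrite !mulr_ge0// ltW.
have K40 : 0 <= K4.
  apply: addr_ge0; apply: mulr_ge0; [exact: mulr_ge0|exact: K30|exact: mulr_ge0|].
  by apply: addr_ge0; exact: mulr_ge0.
exists (W 0 * (D2 * (1 + C)) + K4); first by rewrite addr_ge0.
move=> f mf foo vf.
have U0 : (0 <= U f)%E by apply: nneseries_ge0 => i _ _; exact: Wosc0.
have pf0 := pint_ge0 f.
have Wk0 i : (0 <= (W i)%:E * kosc i f)%E by rewrite mule_ge0 ?lee_fin ?kosc_ge0.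
apply: lime_le; first by apply: is_cvg_nneseries => i _ _; exact: Wk0.
apply: nearW => -[|M].
  rewrite big_geq//; apply: mule_ge0; first by rewrite lee_fin addr_ge0.
  exact: adde_ge0 pf0 U0.
have := kosc_le_pint 0 mf; have := kosc_tail_le M mf foo vf.
rewrite big_nat_recl//= -/(U f); move: U0 pf0.
move: (U f) (pint f) (kosc 0 f) (\sum_(0 <= i < M) _)%E => Uf P k00 Z U0 P0 ZU kP0.
have PU0 : (0 <= P + Uf)%E by exact: adde_ge0.
rewrite EFinD ge0_muleDl ?lee_fin//; apply: leeD.
  apply: (@le_trans _ _ ((W 0 * (D2 * (1 + C)))%:E * P)%E).
    by rewrite [(W 0 * _)%:E]EFinM -muleA; apply: lee_wpmul2l; rewrite ?lee_fin.
  by apply: lee_wpmul2l; rewrite ?lee_fin// leeDl.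
by apply: le_trans ZU _; apply: lee_wpmul2l; rewrite ?lee_fin// leeDr.
Qed.

End series.
End power.
End averaging_kernel.

(** * The ball kernel of a doubling metric measure space *)

Section metric_facts.
Context {R : realType} {X : Type} (d : X -> X -> R) (dP : is_metric d).
Implicit Types (x y z : X) (r : R) (A B : set X).

Lemma dist_xx x : d x x = 0.
Proof. by case: dP => + _ _; move/(_ x x) => [_]; apply. Qed.

Lemma dist_sym x y : d x y = d y x.
Proof. by case: dP. Qed.

Lemma dist_tri x y z : d x z <= d x y + d y z.
Proof. by case: dP. Qed.

Lemma subset_cball x y r r' : d x y + r <= r' -> cball d y r `<=` cball d x r'.
Proof.
move=> xyr z; rewrite /cball /= => yz.
by have := dist_tri x y z; lra.
Qed.

Lemma subset_cballr x r r' : r <= r' -> cball d x r `<=` cball d x r'.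
Proof. by move=> rr'; apply: subset_cball; rewrite dist_xx add0r. Qed.

Lemma dopenU (I : Type) (P : set I) (F : I -> set X) :
  (forall i, P i -> dopen d (F i)) -> dopen d (\bigcup_(i in P) F i).
Proof.
move=> oF x [i Pi /(oF i Pi)[r r0 rF]]; exists r => //.
by move=> y /rF Fiy; exists i.
Qed.

Lemma dopenI A B : dopen d A -> dopen d B -> dopen d (A `&` B).
Proof.
move=> oA oB x [/oA[r r0 rA] /oB[s s0 sB]]; exists (Num.min r s).
  by rewrite lt_min r0 s0.
by move=> y /=; rewrite lt_min => /andP[yr ys]; split; [exact: rA|exact: sB].
Qed.

Lemma dopen_ball x r : dopen d [set y | d x y < r].
Proof.
move=> y /= xy; exists (r - d x y); first by rewrite subr_gt0.
by move=> z /= yz; have := dist_tri x y z; lra.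
Qed.

Lemma dclosedI A B : dclosed d A -> dclosed d B -> dclosed d (A `&` B).
Proof.
move=> cA cB; rewrite /dclosed setCI -bigcup2E; apply: dopenU => -[|[|i]] _ //=.
Qed.

Lemma dclosedU A B : dclosed d A -> dclosed d B -> dclosed d (A `|` B).
Proof. by move=> cA cB; rewrite /dclosed setCU; exact: dopenI. Qed.

Lemma dclosed0 : dclosed d set0.
Proof. by move=> x _; exists 1 => // y _ []. Qed.

Lemma dclosed_cball x r : dclosed d (cball d x r).
Proof.
move=> y /= /negP; rewrite -ltNge => xy; exists (d x y - r); first by rewrite subr_gt0.
move=> z /= yz; apply/negP; rewrite -ltNge.
by have := dist_tri x z y; rewrite (dist_sym z y); lra.
Qed.

Lemma separable_seq : X -> separable_metric d ->
  exists q : nat -> X, forall x e, 0 < e -> exists i, d x (q i) < e.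
Proof.
move=> x0 [D [/countable_injP[h hinj] Ddense]].
have [q qP] : {q : nat -> X & forall n y, D y -> h y = n -> y = q n}.
  apply: (@choice _ _ (fun n x => forall y, D y -> h y = n -> y = x)) => n.
  have [[x [Dx hx]]|nx] := pselect (exists x, D x /\ h x = n).
    by exists x => y Dy hy; apply: hinj; rewrite ?inE// hx.
  by exists x0 => y Dy hy; case: nx; exists y.
exists q => x e e0; have [y Dy xy] := Ddense x e e0.
by exists (h y); rewrite -(qP _ y).
Qed.

End metric_facts.

Section ball_kernel.
Context (dT : measure_display) (T : measurableType dT) (R : realType) (d : T -> T -> R).

(** The measure lives on the whole type and is concentrated on [S] by [ds_null], which avoids a
    subspace; only centres in [S] are controlled. Radii stop at [1] because Ahlfors regularity is
    assumed only there. *)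
Record doubling_space (m : {measure set T -> \bar R}) (S : set T) (Cd : R) : Prop :=
 DoublingSpace {
  ds_metric : is_metric d ;
  ds_separable : separable_metric d ;
  ds_meas : forall F, dclosed d F -> measurable F ;
  ds_closed : dclosed d S ;
  ds_null : m (~` S) = 0%E ;
  ds_gt0 : forall x r, S x -> 0 < r <= 1 -> (0 < m (cball d x r))%E ;
  ds_lty : forall x r, S x -> 0 < r <= 1 -> (m (cball d x r) < +oo)%E ;
  ds_C1 : 1 <= Cd ;
  ds_doubling : forall x r, S x -> 0 < r -> 2 * r <= 1 ->
    (m (cball d x (2 * r)) <= Cd%:E * m (cball d x r))%E }.

Section finiteness.
Context (m : {measure set T -> \bar R}) (S : set T) (Cd : R)
  (dsP : doubling_space m S Cd).
Let dP := ds_metric dsP.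

Lemma ds_measS : measurable S.
Proof. exact: (ds_meas dsP (ds_closed dsP)). Qed.

Lemma ds_meas_cball x r : measurable (cball d x r).
Proof. by apply: (ds_meas dsP); exact: dclosed_cball. Qed.

Lemma ds_meas_open U : dopen d U -> measurable U.
Proof.
move=> oU; rewrite -[U]setCK; apply: measurableC; apply: (ds_meas dsP).
by rewrite /dclosed setCK.
Qed.

Lemma ds_measI A : measurable A -> m (A `&` S) = m A.
Proof.
move=> mA; rewrite (measureDI m mA ds_measS) -[LHS]add0e; congr (_ + _)%E.
apply/esym; apply: (subset_measure0 _ _ _ (ds_null dsP)) => [||x []//].
- by apply: measurableD => //; exact: ds_measS.
- by apply: measurableC; exact: ds_measS.
Qed.

(** The centre may lie off [S]. A ball that meets [S] at [z] lies in the unit ball about [z], as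
    [2 r <= 1]; a ball that misses [S] is null. *)
Lemma ds_cball_lty x r : 0 < r -> r <= 2^-1 -> (m (cball d x r) < +oo)%E.
Proof.
move=> r0 r2; have [[z [xz Sz]]|nS] := pselect (cball d x r `&` S !=set0).
  apply: (@le_lt_trans _ _ (m (cball d z 1))); last by apply: (ds_lty dsP Sz); lra.
  apply: le_measure; rewrite ?inE; try exact: ds_meas_cball.
  apply: subset_cball => //; rewrite (dist_sym dP).
  by have : d x z <= r by []; lra.
rewrite -ds_measI; last exact: ds_meas_cball.
rewrite (_ : _ `&` _ = set0) ?measure0 ?ltry//.
by apply: contrapT => /eqP h; apply: nS; exact/set0P.
Qed.

Lemma ds_sigma_finite : sigma_finite setT m.
Proof.
have [q qP] := separable_seq point (ds_separable dsP).
exists (fun i => cball d (q i) 4^-1).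
  apply/esym/seteqP; split => // x _; have [|i xi] := qP x 4^-1; first lra.
  by exists i => //; rewrite /cball /= (dist_sym dP) ltW.
move=> i; split; first exact: ds_meas_cball.
by apply: ds_cball_lty; lra.
Qed.

End finiteness.

Context (m : {sigma_finite_measure set T -> \bar R}) (S : set T) (Cd : R)
  (dsP : doubling_space m S Cd).
Let dP := ds_metric dsP.
Let r n : R := 2 ^- n.+1.
Let r0 n : 0 < r n. Proof. by rewrite invr_gt0 exprn_gt0. Qed.
Let rS n : r n = 2 * r n.+1.
Proof. by rewrite /r (exprS _ n.+1) invfM mulVKf. Qed.
Let r2 n : 2 * r n <= 1.
Proof. by rewrite /r exprS invfM mulVKf// invf_le1 ?exprn_gt0// exprn_ege1// ler1n. Qed.
Let Cd0 : 0 <= Cd. Proof. exact: le_trans (ds_C1 dsP). Qed.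

Let V n x : R := fine (m (cball d x (r n))).

Let VE n x : S x -> (V n x)%:E = m (cball d x (r n)).
Proof.
move=> Sx; rewrite fineK// ge0_fin_numE//; apply: (ds_lty dsP Sx).
by rewrite r0/=; have := r2 n; have := r0 n; lra.
Qed.

Let V0 n x : S x -> 0 < V n x.
Proof.
move=> Sx; rewrite -lte_fin VE//; apply: (ds_gt0 dsP Sx).
by rewrite r0/=; have := r2 n; have := r0 n; lra.
Qed.

Let V_doubling n x y : S x -> S y -> d x y <= r n -> V n y <= Cd * V n x.
Proof.
move=> Sx Sy xy; rewrite -lee_fin EFinM !VE//.
apply: le_trans (ds_doubling dsP Sx (r0 n) (r2 n)).
apply: le_measure; rewrite ?inE; try exact: (ds_meas_cball dsP).
by apply: subset_cball => //; lra.
Qed.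

(** One factor [Cd] moves the centre from [x] to [y], the other halves the radius. *)
Let V_step n x y : S x -> S y -> d x y <= r n.+1 -> V n x <= Cd ^+ 2 * V n.+1 y.
Proof.
move=> Sx Sy xy; have r4 := r2 n; have := r0 n; rewrite !(rS n) in r4 * => r40.
apply: (@le_trans _ _ (Cd * V n y)).
  by apply: V_doubling => //; rewrite (dist_sym dP) (rS n); have := r0 n.+1; lra.
rewrite expr2 -mulrA ler_wpM2l// -lee_fin EFinM !VE// (rS n).
by apply: (ds_doubling dsP) => //; lra.
Qed.

(* Index [n] stands for the radius [2^-(n+1)], that is for [k = n + 1]. *)
Definition near_pairs n : set (T * T) :=
  [set z | [/\ S z.1, S z.2 & d z.1 z.2 <= r n]].

(** The numerator is symmetric in [x] and [y]; only the volume of the ball about [x] breaks the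
    symmetry, and doubling controls it. *)
Definition ball_kernel n x y : R := \1_(near_pairs n) (x, y) / V n x.

Lemma ball_kernelE n x y : S x -> S y -> d x y <= r n ->
  ball_kernel n x y = (V n x)^-1.
Proof. by move=> Sx Sy xy; rewrite /ball_kernel indicE mem_set ?mul1r. Qed.

Lemma ball_kernel_out n x y : ~ near_pairs n (x, y) -> ball_kernel n x y = 0.
Proof. by move=> nxy; rewrite /ball_kernel indicE memNset ?mul0r. Qed.

(** Membership in the product sigma-algebra has to come from countably many rectangles. Separability
    provides them: [d x y <= e] holds when, for each [n], some [q i] is within [1/(n+1)] of [x] and
    within [e + 1/(n+1)] of [y]. *)
Lemma measurable_near (e : R) : measurable [set z : T * T | d z.1 z.2 <= e].
Proof.
have [q qP] := separable_seq point (ds_separable dsP).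
rewrite (_ : mkset _ = \bigcap_n \bigcup_i
  (cball d (q i) n.+1%:R^-1 `*` cball d (q i) (e + n.+1%:R^-1))).
  apply: bigcap_measurable => // n _; apply: bigcup_measurable => i _.
  by apply: measurableX; exact: (ds_meas_cball dsP).
apply/seteqP; split => -[x y] /=.
  move=> xy n _; have [|i xi] := qP x n.+1%:R^-1; first by rewrite invr_gt0.
  exists i => //; split; rewrite /cball /= (dist_sym dP (q i)) ?(ltW xi)//.
  have := dist_tri dP y x (q i); rewrite (dist_sym dP y x) => /le_trans; apply.
  by rewrite lerD// ltW.
move=> H; apply/ler_addgt0Pr => a a0.
have [n na] : exists n : nat, n.+1%:R^-1 < a / 2.
  have [n _ /(_ n (leqnn n)) na] := near_infty_natSinv_lt (PosNum (divr_gt0 a0 (ltr0n _ 2))).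
  by exists n.
have [i _ [/= xi yi]] := H n I.
have := dist_tri dP x (q i) y; rewrite (dist_sym dP x (q i)).
by move: na xi yi; rewrite /cball /=; move: (n.+1%:R^-1) => u; lra.
Qed.

Lemma measurable_near_pairs n : measurable (near_pairs n).
Proof.
have mS := ds_measS dsP.
rewrite (_ : near_pairs n = (S `*` S) `&` [set z : T * T | d z.1 z.2 <= r n]).
  by apply: measurableI; [exact: measurableX|exact: measurable_near].
by apply/seteqP; split => -[x y] /= => [[]|[[]]].
Qed.

Let jmeas_near (e : R) : jmeas (fun x y => \1_[set z : T * T | d z.1 z.2 <= e] (x, y) : R).
Proof.
rewrite /jmeas (_ : (fun z => _) = \1_[set z : T * T | d z.1 z.2 <= e]).
  by apply/measurable_indicP; exact: measurable_near.
by apply/funext => -[].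
Qed.

Lemma jmeas_ball_kernel n : jmeas (ball_kernel n).
Proof.
apply: jmeasM.
  rewrite /jmeas (_ : (fun z => _) = \1_(near_pairs n)); last by apply/funext => -[].
  by apply/measurable_indicP; exact: measurable_near_pairs.
apply: (jmeas_fst (g := fun x => (V n x)^-1)).
rewrite (_ : (fun x => _) = fun x => V n x `^ (-1)); last first.
  by apply/funext => x /=; rewrite powR_inv1// fine_ge0.
apply: (measurableT_comp (measurable_powR _)).
apply: (measurableT_comp (fine_measurable measurableT)) => //.
(* The volume of a ball as the integral of a section of the set of near pairs, which is measurable
   in [x] by Tonelli. *)
rewrite (_ : (fun x => _) = fun x =>
    (\int[m]_y (\1_[set z : T * T | d z.1 z.2 <= r n] (x, y))%:E)%E).
  by apply: jmeas_int => // x y; rewrite indicE.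
apply/funext => x; rewrite -[cball _ _ _]setIT -integral_indic//; exact: (ds_meas_cball dsP).
Qed.

(** The constant is a square because of [V_step]; [ker_swap] alone would need only [Cd]. *)
Lemma avg_kernel_ball : avg_kernel m S ball_kernel (Cd ^+ 2).
Proof.
have CdC : Cd <= Cd ^+ 2 by rewrite expr2 ler_peMr// (ds_C1 dsP).
have k0 n x y : 0 <= ball_kernel n x y.
  by rewrite mulr_ge0 ?indicE// invr_ge0 fine_ge0.
split => //.
- by rewrite exprn_ege1// (ds_C1 dsP).
- exact: ds_measS dsP.
- exact: jmeas_ball_kernel.
- by move=> n x y Sx; apply: ball_kernel_out => -[].
- move=> n x Sx.
  transitivity (\int[m]_y (((V n x)^-1)%:E * (\1_(cball d x (r n) `&` S) y)%:E))%E.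
    apply: eq_integral => y _; rewrite -EFinM; congr EFin.
    have [[xy Sy]|nxy] := pselect ((cball d x (r n) `&` S) y).
      by rewrite ball_kernelE// indicE mem_set// mulr1.
    by rewrite indicE memNset// mulr0 ball_kernel_out// => -[/= _ Sy xy]; apply: nxy.
  have mB := ds_meas_cball dsP x (r n).
  have mS := ds_measS dsP.
  rewrite ge0_integralZl//; last 2 first.
  - by apply/measurable_EFinP/measurable_indicP; exact: measurableI.
  - by rewrite lee_fin invr_ge0 fine_ge0.
  rewrite integral_indic//; last exact: measurableI.
  rewrite setIT.
  transitivity (((V n x)^-1)%:E * (V n x)%:E)%E.
    by congr (_ * _)%E; rewrite VE//; exact: (ds_measI dsP mB).
  rewrite -EFinM mulVf// gt_eqF//.
  exact: V0.
- move=> n x; exists (V n x)^-1 => y; apply: ler_piMl.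
    by rewrite invr_ge0 fine_ge0.
  by rewrite indicE; case: (_ \in _).
- move=> n x Sx; rewrite ball_kernelE ?(dist_xx dP) ?(ltW (r0 n))//.
  by rewrite invr_neq0// gt_eqF// V0.
- move=> n x y; have [[/= Sx Sy xy]|nxy] := pselect (near_pairs n (x, y)); last first.
    by rewrite ball_kernel_out// mulr_ge0// exprn_ge0.
  have yx : d y x <= r n by rewrite (dist_sym dP).
  rewrite !ball_kernelE// ler_pdivlMr ?V0// mulrC ler_pdivrMr ?V0//.
  by apply: le_trans (V_doubling Sx Sy xy) _; rewrite ler_wpM2r// ltW// V0.
- move=> n x y z kxy.
  have [[/= Sx Sy xy]|/ball_kernel_out] := pselect (near_pairs n.+1 (x, y)); last first.
    by move=> k00; rewrite k00 eqxx in kxy.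
  have [[/= _ Sz yz]|nyz] := pselect (near_pairs n.+1 (y, z)); last first.
    by rewrite ball_kernel_out// mulr_ge0// exprn_ge0.
  have xz : d x z <= r n by rewrite (rS n); have := dist_tri dP x y z; lra.
  rewrite !ball_kernelE// ler_pdivlMr ?V0// mulrC ler_pdivrMr ?V0//.
  exact: V_step.
Qed.

End ball_kernel.

(** * Convergence of averages in L_p *)

Lemma cvge0_eventually_le (R : realType) (u : nat -> \bar R) (e : R) :
  u @ \oo --> 0%E -> 0 < e -> exists N, forall n, (N <= n)%N -> (u n <= e%:E)%E.
Proof.
move=> /fine_cvgP[[N1 _ N1P] /cvgrPdist_lt/(_ _)] + e0 => /(_ e e0)[N2 _ N2P].
exists (maxn N1 N2) => n; rewrite geq_max => /andP[n1 n2].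
rewrite -(fineK (N1P n n1)) lee_fin.
have := N2P n n2; rewrite /= sub0r normrN => /ltW; apply: le_trans.
exact: ler_norm.
Qed.

Lemma measure_remainder_le d (T : measurableType d) (R : realType)
    (m : {measure set T -> \bar R}) (A : set T) (B : nat -> set T) (e : R) :
  measurable A -> (m A < +oo)%E -> (forall i, measurable (B i)) ->
  nondecreasing_seq B -> A `<=` \bigcup_i B i -> 0 < e ->
  exists i, (m (A `\` B i) <= e%:E)%E.
Proof.
move=> mA Aoo mB ndB AB e0.
have mAB i : measurable (A `\` B i) by exact: measurableD.
have cap0 : \bigcap_i (A `\` B i) = set0.
  rewrite -subset0 => x xAB; have [Ax _] := xAB 0%N I.
  by have [i _ Bx] := AB x Ax; have [_] := xAB i I; apply.
have : (m \o (fun i => A `\` B i)) @ \oo --> 0%E.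
  rewrite -(measure0 m) -cap0; apply: nonincreasing_cvg_mu => //.
  - apply: le_lt_trans Aoo; apply: le_measure; rewrite ?inE//.
  - by rewrite cap0.
  - move=> i j ij; apply/subsetPset; apply: setDS; exact/subsetPset/ndB.
move=> /cvge0_eventually_le/(_ e0)[N NP]; exists N; exact: NP.
Qed.

Section kernel_vanish.
Context (dT : measure_display) (T : measurableType dT) (R : realType)
  (m : {sigma_finite_measure set T -> \bar R}) (S : set T)
  (k : nat -> T -> T -> R) (C : R) (kP : avg_kernel m S k C) (p : R) (p1 : 1 < p).
Implicit Types (f g : T -> R).
Let D2 : R := 2 `^ (p - 1).
Let D20 : 0 < D2. Proof. exact: powR_gt0. Qed.
Let C0 : 0 < 1 + C. Proof. by rewrite ltr_wpDr// (le_trans ler01 (ker_C1 kP)). Qed.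

Lemma kvanishD f g : measurable_fun setT f -> measurable_fun setT g ->
  kvanish m k p f -> kvanish m k p g -> kvanish m k p (f \+ g).
Proof.
move=> mf mg vf vg e e0.
have e'0 : 0 < e / (D2 * 2) by rewrite divr_gt0// mulr_gt0.
have [N1 N1P] := vf _ e'0; have [N2 N2P] := vg _ e'0.
exists (maxn N1 N2) => n; rewrite geq_max => /andP[n1 n2].
apply: le_trans (kosc_add kP p1 n mf mg) _.
apply: (@le_trans _ _ (D2%:E * ((e / (D2 * 2))%:E + (e / (D2 * 2))%:E))%E).
  by apply: lee_wpmul2l; [rewrite lee_fin ltW|apply: leeD; [exact: N1P|exact: N2P]].
rewrite -EFinD -EFinM lee_fin le_eqVlt; apply/orP; left; apply/eqP.
by field; rewrite gt_eqF.
Qed.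

Lemma kvanishZ f c : measurable_fun setT f -> kvanish m k p f ->
  kvanish m k p (fun x => c * f x).
Proof.
move=> mf vf e e0.
have cp0 : 0 < `|c| `^ p + 1 by rewrite ltr_wpDl ?powR_ge0.
have [N NP] := vf _ (divr_gt0 e0 cp0).
exists N => n Nn; rewrite (kosc_scale kP)//.
apply: (@le_trans _ _ ((`|c| `^ p)%:E * (e / (`|c| `^ p + 1))%:E)%E).
  by apply: lee_wpmul2l; [rewrite lee_fin powR_ge0|exact: NP].
rewrite -EFinM lee_fin mulrCA ler_piMr ?(ltW e0)//.
by rewrite ler_pdivrMr// mul1r lerDl.
Qed.

Lemma kvanish0 : kvanish m k p (fun=> 0).
Proof.
move=> e e0; exists 0%N => n _; rewrite (_ : kosc _ _ _ _ _ = 0%E) ?lee_fin ?ltW//.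
apply: integral0_eq => x _; apply: integral0_eq => y _.
by rewrite subrr normr0 powR0 ?mulr0// gt_eqF// (lt_trans ltr01).
Qed.

Lemma kvanish_sum (I : Type) (s : seq I) (F : I -> T -> R) :
  (forall i, measurable_fun setT (F i)) -> (forall i, kvanish m k p (F i)) ->
  kvanish m k p (fun x => \sum_(i <- s) F i x).
Proof.
move=> mF vF; elim: s => [|i s IH].
  by under eq_fun do rewrite big_nil; exact: kvanish0.
have -> : (fun x => \sum_(j <- i :: s) F j x) = F i \+ (fun x => \sum_(j <- s) F j x).
  by apply/funext => x; rewrite big_cons.
by apply: (kvanishD (mF i) _ (vF i) IH); exact: measurable_sum.
Qed.

(** Write [f] as [(f - g) + g]: the first part is small uniformly in [n] by [kosc_le_pint], the
    second for large [n]. *)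
Lemma kvanish_approx f : measurable_fun setT f ->
  (forall e : R, 0 < e -> exists g, [/\ measurable_fun setT g, kvanish m k p g &
    (pint m S p (f \- g)%R <= e%:E)%E]) -> kvanish m k p f.
Proof.
move=> mf H e e0.
have e1 : 0 < e / (D2 * (D2 * (1 + C)) * 2) by rewrite divr_gt0// !mulr_gt0.
have e2 : 0 < e / (D2 * 2) by rewrite divr_gt0// mulr_gt0.
have [g [mg vg fg]] := H _ e1.
have [N NP] := vg _ e2; exists N => n Nn.
have mfg : measurable_fun setT (f \- g) by exact: measurable_funB.
have -> : f = (f \- g) \+ g by apply/funext => x /=; rewrite subrK.
apply: le_trans (kosc_add kP p1 n mfg mg) _.
apply: (@le_trans _ _ (D2%:E * ((D2 * (1 + C))%:E *
    (e / (D2 * (D2 * (1 + C)) * 2))%:E + (e / (D2 * 2))%:E))%E).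
  apply: lee_wpmul2l; [by rewrite lee_fin ltW|apply: leeD; last exact: NP].
  apply: le_trans (kosc_le_pint kP p1 n mfg) _; apply: lee_wpmul2l => //.
  by rewrite lee_fin mulr_ge0// ltW.
rewrite -(EFinM (D2 * (1 + C))) -EFinD -EFinM lee_fin le_eqVlt; apply/orP; left; apply/eqP.
by field; rewrite !gt_eqF.
Qed.

Lemma pint_le_measure (A : set T) f : measurable A ->
  (forall x, S x -> `|f x| <= \1_A x) -> (pint m S p f <= m A)%E.
Proof.
move=> mA fA; have mS := ker_dom kP; have p0 : 0 < p by exact: lt_trans p1.
apply: (@le_trans _ _ (\int[m]_(x in S) (\1_A x)%:E)%E).
  apply: ge0_le_integralW => x Sx; rewrite lee_fin ?powR_ge0//.
  apply: (@le_trans _ _ (\1_A x `^ p)).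
    by rewrite ge0_ler_powR ?nnegrE ?(ltW p0) ?fA// indicE.
  by rewrite indicE; case: (_ \in _); rewrite ?powR1// powR0 ?gt_eqF.
by rewrite integral_indic//; apply: le_measure; rewrite ?inE//; exact: measurableI.
Qed.

End kernel_vanish.

(** * From indicators of closed sets to all of L_p, for the ball kernel *)

Section ball_vanish.
Context (dT : measure_display) (T : measurableType dT) (R : realType) (d : T -> T -> R)
  (m : {sigma_finite_measure set T -> \bar R}) (S : set T) (Cd : R)
  (dsP : doubling_space d m S Cd) (p : R) (p1 : 1 < p).
Let dP := ds_metric dsP.
Let k := ball_kernel d m S.
Let kP : avg_kernel m S k (Cd ^+ 2) := avg_kernel_ball dsP.
Let C := Cd ^+ 2.
Let C0 : 0 <= C. Proof. exact: le_trans (ker_C1 kP). Qed.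
Let p0 : 0 < p. Proof. exact: lt_trans p1. Qed.

(** Only pairs with exactly one point in [F] contribute. The one outside then lies in the
    [2^-n]-neighbourhood [U n] of [F], so the double integral is at most [(1 + C) * m(U n - F)].
    These sets decrease to the empty set because [F] is closed. *)
Let kvanish_closed (F : set T) : dclosed d F ->
  (m [set x | exists2 y, F y & (d x y < 4^-1)%R] < +oo)%E -> kvanish m k p \1_F.
Proof.
move=> cF Foo.
have mF : measurable F by exact: (ds_meas dsP).
pose U n := [set x | exists2 y, F y & d x y < (2 : R) ^- n].
have mU n : measurable (U n).
  apply: (ds_meas_open dsP).
  rewrite (_ : U n = \bigcup_(y in F) [set x | d y x < 2 ^- n]); last first.
    by apply/seteqP; split => x [y Fy xy]; exists y => //=; rewrite (dist_sym dP).
  by apply: dopenU => y _; exact: dopen_ball.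
have ndU i j : (i <= j)%N -> U j `<=` U i.
  move=> ij x [y Fy xy]; exists y => //; apply: lt_le_trans xy _.
  by rewrite lef_pV2 ?posrE ?exprn_gt0// ler_eXn2l// ltr1n.
have vanV : forall e : R, 0 < e ->
    exists N, forall n, (N <= n)%N -> (m (U n `\` F) <= e%:E)%E.
  move=> e e0.
  (* The shift by two starts the sequence at the neighbourhood of radius [1/4], whose measure is
     finite by hypothesis. *)
  have cap0 : \bigcap_n (U n.+2 `\` F) = set0.
    rewrite -subset0 => x xUF; have [_ nFx] := xUF 0%N I.
    have [rho rho0 rhoF] := cF x nFx.
    have [n nrho] : exists n, (2 : R) ^- n.+2 < rho.
      have [n _ /(_ n (leqnn n)) /= nrho] := near_infty_natSinv_lt (PosNum rho0).
      exists n; apply: le_lt_trans nrho; rewrite lef_pV2 ?posrE ?exprn_gt0//.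
      rewrite -natrX ler_nat; apply: leq_trans (ltnW (ltn_expl n.+1 (isT : 1 < 2)%N)) _.
      by rewrite leq_exp2l.
    have [[y Fy xy] _] := xUF n I.
    by apply: (rhoF y) => //=; exact: lt_trans nrho.
  have : (m \o (fun n => U n.+2 `\` F)) @ \oo --> 0%E.
    rewrite -(measure0 m) -cap0; apply: nonincreasing_cvg_mu => //.
    - apply: le_lt_trans Foo; apply: le_measure; rewrite ?inE//.
      + exact: measurableD.
      + by have := mU 2%N; rewrite /U (_ : (2 : R) ^- 2 = 4^-1)//; congr (_^-1); ring.
      + move=> x [[y Fy xy] _]; exists y => //.
        by rewrite (_ : (4 : R)^-1 = 2 ^- 2)//; congr (_^-1); ring.
    - by move=> n; exact: measurableD.
    - by rewrite cap0.
    - by move=> i j ij; apply/subsetPset; apply: setSD; apply: ndU; rewrite !ltnS.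
  move=> /cvge0_eventually_le/(_ e0)[N NP]; exists N.+2 => n Nn.
  by case: n Nn => [|[|n]]//; rewrite !ltnS => /NP.
move=> e e0; have e'0 : 0 < e / (1 + C) by rewrite divr_gt0// ltr_wpDr.
have [N NP] := vanV _ e'0; exists N => n Nn.
pose G x y : R := k n x y * (\1_(~` F) x * \1_F y).
have mk := ker_meas kP n; have k0 := ker_ge0 kP n.
have mI (A : set T) : measurable A -> measurable_fun setT (\1_A : T -> R).
  by move=> mA; exact/measurable_indicP.
have mG : jmeas G.
  apply: jmeasM => //; apply: jmeasM; [apply: jmeas_fst|apply: jmeas_snd]; apply: mI => //.
  exact: measurableC.
have G0 x y : 0 <= G x y.
  by apply: mulr_ge0; [exact: k0|rewrite !indicE mulr_ge0].
have GV : (dint m G <= m (U n `\` F))%E.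
  have mV : measurable (U n `\` F) by exact: measurableD.
  apply: (@le_trans _ _ (dint m (fun x y => k n x y * \1_(U n `\` F) x))).
    apply: le_dint => // x y; rewrite /G.
    have [kxy|/eqP kxy] := eqVneq (k n x y) 0; first by rewrite kxy !mul0r.
    rewrite ler_wpM2l// !indicE.
    have [Fy|Fy] := boolP (y \in F); last by rewrite mulr0.
    rewrite mulr1 in_setC; have [//|Fx] := boolP (x \in F).
    rewrite mem_set//; split; last by move=> Fx'; move/negP: Fx; apply; exact/mem_set.
    exists y; first exact/set_mem.
    have : near_pairs d S n (x, y).
      by apply: contrapT => nxy; apply: kxy; exact: ball_kernel_out.
    move=> [_ _ /=] /le_lt_trans; apply.
    by rewrite ltf_pV2 ?posrE ?exprn_gt0// ltr_eXn2l// ltr1n.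
  rewrite (ker_avg_fst kP _ (mI _ mV)); last by move=> x; rewrite indicE.
  have mS := ker_dom kP.
  by rewrite integral_indic//; apply: le_measure; rewrite ?inE//; exact: measurableI.
(* [G] covers [x] outside and [y] inside [F]; the opposite case becomes [G y x] through
   [ker_swap]. *)
apply: (@le_trans _ _ (dint m (fun x y => G x y + C * G y x))).
  apply: le_dint => x y; first by rewrite mulr_ge0 ?powR_ge0.
  have swp := ker_swap kP n x y.
  rewrite /G !indicE !in_setC; have [Fx|Fx] := boolP (x \in F);
    have [Fy|Fy] := boolP (y \in F); rewrite /= ?mulr0 ?mul0r ?mulr1 ?addr0 ?add0r
      ?subrr ?sub0r ?subr0 ?normrN ?normr0 ?normr1 ?powR1 ?powR0 ?mulr1 ?mulr0//.
  - by rewrite gt_eqF.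
  - by rewrite gt_eqF.
have mGC : jmeas (fun x y => G y x) by exact: jmeasC.
rewrite dintD//; [|by apply: jmeasM => //; exact: measurable_cst|by move=> x y; rewrite mulr_ge0].
rewrite dintZ// -(dintC m mG)//.
have -> : (dint m G + C%:E * dint m G = (1 + C)%:E * dint m G)%E.
  by rewrite EFinD ge0_muleDl ?lee_fin// mul1e.
apply: (@le_trans _ _ ((1 + C)%:E * (e / (1 + C))%:E)%E).
  apply: lee_wpmul2l; first by rewrite lee_fin addr_ge0.
  by apply: le_trans GV _; exact: NP.
by rewrite -EFinM lee_fin mulrC divfK// gt_eqF// ltr_wpDr.
Qed.

(** Borel hulls. Only the part of [E] in [S] has to be covered, since [m] does not charge the rest;
    for the Hausdorff measure this is [HSm_hull]. *)
Hypothesis reg : forall E, measurable E -> (m E < +oo)%E ->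
  exists B, [/\ <<s dclosed d >> B, E `&` S `<=` B & (m B <= m E)%E].

Let kvanish_indic (E : set T) : measurable E -> (m E < +oo)%E -> kvanish m k p \1_E.
Proof.
move=> mE Eoo.
have [q qP] := separable_seq point (ds_separable dsP).
pose D N := \bigcup_(i < N) cball d (q i) 4^-1.
have mI (A : set T) : measurable A -> measurable_fun setT (\1_A : T -> R).
  by move=> mA; exact/measurable_indicP.
have cD N : dclosed d (D N).
  rewrite /D bigcup_mkord; elim/big_ind : _ => //.
  - exact: dclosed0.
  - by move=> A B cA cB; exact: dclosedU.
  - by move=> i _; exact: dclosed_cball.
have mD N : measurable (D N) by exact: (ds_meas dsP).
have ndD : nondecreasing_seq D.
  move=> i j ij; apply/subsetPset => x [l /= li xl]; exists l => //=.
  exact: leq_trans ij.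
have DT : setT `<=` \bigcup_N D N.
  move=> x _; have [|i xi] := qP x 4^-1; first lra.
  by exists i.+1 => //; exists i => //=; rewrite /cball /= (dist_sym dP) ltW.
(* Used at radius [1/4] for [D N] and at radius [1/2] for its [1/4]-neighbourhood, the largest
   radius that [ds_cball_lty] allows. *)
have fin N (e : R) : 0 < e -> e <= 2^-1 -> (m (\bigcup_(i < N) cball d (q i) e) < +oo)%E.
  move=> e0 e2; rewrite bigcup_mkord.
  suff [] : measurable (\big[setU/set0]_(i < N) cball d (q i) e) /\
    (m (\big[setU/set0]_(i < N) cball d (q i) e) < +oo)%E by [].
  apply: (big_ind (fun A => measurable A /\ (m A < +oo)%E)).
  - by split => //; rewrite measure0 ltry.
  - move=> A B [mA Aoo] [mB Boo]; split; first exact: measurableU.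
    by apply: le_lt_trans (measureU2 m mA mB) _; rewrite lte_add_pinfty.
  - by move=> i _; split; [exact: (ds_meas_cball dsP)|exact: (ds_cball_lty dsP)].
have Doo N : (m (D N) < +oo)%E by apply: fin; lra.
have nbD N A : A `<=` D N -> (m [set x | exists2 y, A y & (d x y < 4^-1)%R] < +oo)%E.
  move=> AD; apply: le_lt_trans (fin N 2^-1 _ _); [|lra|lra].
  apply: le_measure; rewrite ?inE.
  - apply: (ds_meas_open dsP).
    rewrite (_ : mkset _ = \bigcup_(y in A) [set x | d y x < 4^-1]).
      by apply: dopenU => y _; exact: dopen_ball.
    by apply/seteqP; split => x [y Fy xy]; exists y => //=; rewrite (dist_sym dP).
  - by apply: bigcup_measurable => i _; exact: (ds_meas_cball dsP).
  - move=> x [y /AD[i iN yi] xy]; exists i => //.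
    have := dist_tri dP (q i) y x; rewrite (dist_sym dP y x).
    by move: yi; rewrite /cball /=; lra.
have vB N B : <<s dclosed d >> B -> kvanish m k p \1_(B `&` D N).
  (* Intersecting with [D N] keeps all measures finite, as closed sets and increasing unions
     require. Proper differences follow by linearity, increasing unions by approximation in L_p. *)
  pose H : set (set T) := [set B | measurable B /\ kvanish m k p \1_(B `&` D N)].
  suff : <<s dclosed d >> `<=` H by move=> + HB => /(_ B HB)[].
  apply: lambda_system_subset => //.
  - by move=> A A' cA cA'; exact: dclosedI.
  - split; first by [].
    + split; first exact: measurableT.
      by rewrite setTI; apply: kvanish_closed; [exact: cD|apply: nbD; exact: subset_refl].
    + move=> A B' B'A [mA vA] [mB' vB']; split; first exact: measurableD.
      have mAD : measurable_fun setT (\1_(A `&` D N) : T -> R) by apply: mI; exact: measurableI.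
      have mBD : measurable_fun setT (\1_(B' `&` D N) : T -> R) by apply: mI; exact: measurableI.
      rewrite (_ : \1__ = \1_(A `&` D N) \+ (fun x => (-1) * \1_(B' `&` D N) x)).
        apply: (kvanishD kP p1 mAD _ vA (kvanishZ kP (-1) mBD vB')).
        exact: measurable_funM.
      apply/funext => x /=; rewrite !indicE !(in_setD, in_setI, in_setC) mulN1r.
      have : x \in B' -> x \in A by move=> /set_mem/B'A/mem_set.
      by case: (x \in A); case: (x \in B'); case: (x \in D N) => //= h;
        rewrite ?subr0 ?subrr//; have := h isT.
    + move=> F ndF HF; have mF i : measurable (F i) by case: (HF i).
      have mUF : measurable (\bigcup_i F i) by exact: bigcup_measurable.
      have mUFD : measurable (\bigcup_i F i `&` D N) by exact: measurableI.
      split; [exact: mUF|apply: (kvanish_approx kP p1); first exact: mI].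
      move=> e e0.
      have UFDoo : (m (\bigcup_i F i `&` D N) < +oo)%E.
        by apply: le_lt_trans (Doo N); apply: le_measure; rewrite ?inE.
      have [i Ai] := measure_remainder_le mUFD UFDoo mF ndF (@subIsetl _ _ _) e0.
      exists \1_(F i `&` D N); split; [by apply: mI; exact: measurableI|by case: (HF i)|].
      apply: le_trans (pint_le_measure kP p1 (A := (\bigcup_i F i `&` D N) `\` F i) _ _) Ai.
        exact: measurableD.
      move=> x _ /=; rewrite !indicE !(in_setD, in_setI, in_setC).
      have : x \in F i -> x \in \bigcup_i F i by move=> /set_mem Fx; apply/mem_set; exists i.
      by case: (x \in F i); case: (x \in \bigcup_i F i); case: (x \in D N) => //= h;
        rewrite ?subrr ?subr0 ?normr0 ?normr1//; have := h isT.
  - move=> F cF; split; first exact: (ds_meas dsP cF).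
    by apply: kvanish_closed; [exact: dclosedI (cD N)|apply: nbD; exact: subIsetr].
have [B [sB EB BE]] := reg mE Eoo.
have mB : measurable B.
  by apply: smallest_sub sB; [exact: sigma_algebra_measurable|move=> F cF; exact: (ds_meas dsP)].
(* The mass of [E] is carried by its part in [S], which lies in [B]. Additivity gives
   [m E + m(B - E) <= m B <= m E], and the finite [m E] cancels. *)
have BE0 : m (B `\` E) = 0%E.
  apply/eqP; rewrite eq_le measure_ge0 andbT.
  have : (m E + m (B `\` E) <= m E + 0)%E.
    rewrite adde0; apply: le_trans BE; rewrite (measureDI m mB mE) addeC.
    apply: leeD => //; rewrite -(ds_measI dsP mE).
    apply: le_measure; rewrite ?inE; [|exact: measurableI|].
      by apply: measurableI => //; exact: (ds_measS dsP).
    by move=> x [Ex Sx]; split => //; apply: EB.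
  by rewrite leeD2lE// ge0_fin_numE.
apply: (kvanish_approx kP p1); first exact: mI.
move=> e e0.
have [N EN] := measure_remainder_le mE Eoo mD ndD (fun x _ => DT x I) e0.
exists \1_(B `&` D N); split; [by apply: mI; exact: measurableI|exact: vB|].
have mED : measurable (E `\` D N) by exact: measurableD.
have mBE : measurable (B `\` E) by exact: measurableD.
apply: (@le_trans _ _ (m ((E `\` D N) `|` (B `\` E)))); last first.
  by apply: le_trans (measureU2 m mED mBE) _; rewrite [X in (_ + X)%E]BE0 adde0.
apply: (pint_le_measure kP p1); first exact: measurableU.
move=> x Sx /=; rewrite !indicE !(in_setU, in_setD, in_setI, in_setC).
have EBx : x \in E -> x \in B by move=> /set_mem Ex; apply/mem_set/EB.
move: EBx; case: (x \in E); case: (x \in B); case: (x \in D N) => //= h;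
  rewrite ?subrr ?subr0 ?sub0r ?normrN ?normr0 ?normr1//; by have := h isT.
Qed.

Import HBNNSimple.

(** Simple functions increasing to [g] converge in L_p by dominated convergence. Each of their
    non-zero level sets has finite measure by Chebyshev's inequality. *)
Let kvanish_ge0 (g : T -> R) : measurable_fun setT g -> (forall x, 0 <= g x) ->
  (pint m S p g < +oo)%E -> kvanish m k p g.
Proof.
move=> mg g0 goo; have mS := ker_dom kP.
have mgE : measurable_fun setT (EFin \o g) by exact/measurable_EFinP.
pose h := nnsfun_approx measurableT mgE.
have hg x : (fun n => h n x) @ \oo --> g x.
  have g0E y : setT y -> (0 <= (EFin \o g) y)%E by rewrite lee_fin.
  by have /fine_cvgP[_ h1] := cvg_nnsfun_approx measurableT mgE g0E (I : setT x).
have hle n x : h n x <= g x.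
  rewrite -(cvg_lim (@Rhausdorff R) (hg x)).
  apply: nondecreasing_cvgn_le; last by apply/cvg_ex; exists (g x); exact: hg.
  by move=> i j ij; have /lefP := nd_nnsfun_approx measurableT mgE ij; exact.
apply: (kvanish_approx kP p1) => // e e0.
have : (fun n => pint m S p (g \- h n)) @ \oo --> 0%E.
  rewrite -(integral0 m S).
  have mgp := measurable_norm_powR p mg.
  apply: (@dominated_cvg _ _ _ m S mS (fun n x => (`|g x - h n x| `^ p)%:E) (cst 0%E)
     (fun x => (`|g x| `^ p)%:E)).
  - move=> n; apply/measurable_EFinP/measurable_funTS/measurable_norm_powR.
    by apply: measurable_funB.
  - move=> x _; apply/fine_cvgP; split; first exact: nearW.
    apply/cvgrPdist_le => a a0 /=.
    (* Capping at [1] gives [u^p <= u] for the distance [u], so no root of [a] has to be taken. *)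
    have a10 : 0 < Num.min a 1 by rewrite lt_min a0 ltr01.
    have /cvgrPdist_le/(_ _ a10) := hg x; apply: filterS => n /=.
    rewrite le_min => /andP[gha gh1].
    rewrite sub0r normrN ger0_norm ?powR_ge0//; apply: le_trans gha.
    have [->|gh0] := eqVneq `|g x - h n x| 0; first by rewrite powR0 ?gt_eqF.
    by apply: ge1r_powR; rewrite ?(ltW p1)// gh1 andbT lt_neqAle eq_sym gh0 normr_ge0.
  - by [].
  - apply/integrableP; split; first exact/measurable_EFinP/measurable_funTS.
    by under eq_integral do rewrite gee0_abs ?lee_fin ?powR_ge0//.
  - move=> n x _; rewrite abse_EFin lee_fin ger0_norm ?powR_ge0//.
    rewrite ge0_ler_powR ?nnegrE ?(ltW p0)// !ger0_norm ?subr_ge0 ?hle//.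
    by rewrite lerBlDr lerDl.
move=> /cvge0_eventually_le/(_ e0)[N NP]; exists (h N); split; last exact: NP.
  by [].
rewrite (_ : (h N : T -> R) = fun x => \sum_(y <- finmap.enum_fset (fset_set (range (h N))))
    y * \1_(h N @^-1` [set y]) x); last first.
  by apply/funext => x; rewrite [LHS]fimfunE fsbig_finite.
have mA y : measurable (h N @^-1` [set y]) by exact: measurable_sfunP.
have mI y : measurable_fun setT (\1_(h N @^-1` [set y]) : T -> R) by exact/measurable_indicP.
apply: (kvanish_sum kP p1); first by move=> y; exact: measurable_funM.
(* The value [0] is set apart because its level set may have infinite measure. *)
move=> y; have [->|y0] := eqVneq y 0.
  by rewrite (_ : (fun x => _) = fun=> 0);
    [exact: (kvanish0 m k p1)|apply/funext => x; rewrite mul0r].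
apply: (kvanishZ kP); first exact: mI.
apply: kvanish_indic; first exact: mA.
have yp0 : 0 < `|y| `^ p by rewrite powR_gt0 ?normr_gt0.
apply: (@le_lt_trans _ _ (((`|y| `^ p)^-1)%:E * pint m S p g)%E); last first.
  by apply: lte_mul_pinfty => //; rewrite lee_fin invr_ge0 powR_ge0.
rewrite lee_pdivlMl// -(ds_measI dsP (mA y)).
rewrite -[X in (_ * X)%E](integral_indic m mS (mA y)).
have mIS : measurable_fun S (fun x => (\1_(h N @^-1` [set y]) x)%:E : \bar R).
  exact/measurable_EFinP/measurable_funTS/mI.
rewrite -(ge0_integralZl m mS mIS) ?lee_fin ?powR_ge0//.
apply: ge0_le_integralW => x Sx.
  by rewrite -EFinM lee_fin mulr_ge0 ?powR_ge0// indicE.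
rewrite -EFinM lee_fin indicE; have [/set_mem/= <-|_] := boolP (x \in _); last first.
  by rewrite mulr0 powR_ge0.
by rewrite mulr1 ge0_ler_powR ?nnegrE ?(ltW p0)// !ger0_norm ?g0// hle.
Qed.

Lemma kvanish_Lp (f : T -> R) : measurable_fun setT f -> (pint m S p f < +oo)%E ->
  kvanish m k p f.
Proof.
move=> mf foo.
have mfp : measurable_fun setT (fun x => Num.max (f x) 0) by exact: measurable_maxr.
have mfn : measurable_fun setT (fun x => Num.max (- f x) 0).
  by apply: measurable_maxr => //; exact: measurableT_comp.
have lef (u : T -> R) : (forall x, 0 <= u x) -> (forall x, u x <= `|f x|) ->
    (pint m S p u < +oo)%E.
  move=> u0 uf; apply: le_lt_trans foo; apply: ge0_le_integralW => x _.
    by rewrite lee_fin powR_ge0.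
  by rewrite lee_fin ge0_ler_powR ?nnegrE ?(ltW p0)// ger0_norm.
have -> : f = (fun x => Num.max (f x) 0) \+ (fun x => (-1) * Num.max (- f x) 0).
  by apply/funext => x /=; case: (lerP (f x) 0) => fx; case: (lerP (- f x) 0); lra.
apply: (kvanishD kP p1 mfp).
- exact: measurable_funM.
- apply: kvanish_ge0; [exact: mfp|by move=> x; rewrite le_max lexx orbT|].
  by apply: lef => x; rewrite ?le_max ?lexx ?orbT// ge_max ler_norm normr_ge0.
- apply: (kvanishZ kP); first exact: mfn.
  apply: kvanish_ge0; [exact: mfn|by move=> x; rewrite le_max lexx orbT|].
  by apply: lef => x; rewrite ?le_max ?lexx ?orbT// ge_max -normrN ler_norm normr_ge0.
Qed.

End ball_vanish.

(** * The codimension Hausdorff measure *)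

Section codim_hausdorff.
Context {R : realType} {X : pointedType} (d : X -> X -> R)
  (mu : {outer_measure set X -> \bar R}) (theta : R) (dP : is_metric d).
Implicit Types (A B E F : set X).
Local Notation H := (Hth d mu theta).
Local Notation Hd := (Hdelta d mu theta).

Lemma Hdelta_ge0 (a : R) A : (0 <= Hd a A)%E.
Proof. exact/cover_ext_ge0/Hcost_ge0. Qed.

Lemma Hdelta_le_Hth (a : R) A : 0 < a -> (Hd a A <= H A)%E.
Proof. by move=> a0; apply: ereal_sup_ubound; exists a. Qed.

Lemma le_Hdelta (a b : R) A : a <= b -> (Hd b A <= Hd a A)%E.
Proof.
move=> ab; apply: ereal_inf_le_tmp => _ [G [aG AG] <-]; exists G => //; split => // i.
by have := aG i; case: (G i) => //= xr /andP[-> /lt_le_trans]; apply.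
Qed.

Lemma Hdelta_le_cost (a : R) A (G : nat -> option (X * R)) :
  covers (fun xr : X * R => 0 < xr.2 < a) (fun xr => cball d xr.1 xr.2) A G ->
  (Hd a A <= \sum_(i <oo) occost (Hcost d mu theta) (G i))%E.
Proof. by move=> AG; apply: ereal_inf_lbound; exists G. Qed.

Lemma occost_ge0 o : (0 <= occost (Hcost d mu theta) o)%E.
Proof. by case: o => //= xr; exact: Hcost_ge0. Qed.

(* A ball of radius less than [e / 2] cannot meet both [A] and [B]. *)
Lemma Hdelta_sepU (a e : R) A B : 2 * a <= e ->
  (forall x y, A x -> B y -> e <= d x y) -> (Hd a A + Hd a B <= Hd a (A `|` B))%E.
Proof.
move=> ae AB; apply: le_ereal_inf_tmp => _ [G [aG ABG] <-].
pose b := ocset (fun xr : X * R => cball d xr.1 xr.2).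
pose GC (E : set X) i := if `[< b (G i) `&` E !=set0 >] then G i else None.
have GCE E : E `<=` A `|` B -> covers (fun xr : X * R => 0 < xr.2 < a)
    (fun xr => cball d xr.1 xr.2) E (GC E).
  move=> EAB; split => [i|x Ex]; first by rewrite /GC; case: asboolP.
  have [i _ xi] := ABG x (EAB x Ex); exists i => //; rewrite /GC.
  by case: asboolP => // -[]; exists x.
have c0 := occost_ge0.
apply: (@le_trans _ _ (\sum_(i <oo) (occost (Hcost d mu theta) (GC A i)
    + occost (Hcost d mu theta) (GC B i)))%E); last first.
  apply: lee_nneseries => [i _ _|i _]; first exact: adde_ge0.
  rewrite /GC; case: asboolP => [[x [xi Ax]]|_]; last by rewrite add0e; case: asboolP => _; [|exact: c0].
  case: asboolP => [[y [yi By]]|_]; last by rewrite adde0.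
  move: xi yi (aG i) (AB x y Ax By); rewrite /b /cball; case: (G i) => //= -[z r] /=.
  move=> zx zy /andP[_ ra]; have := dist_tri dP x z y; rewrite (dist_sym dP x z).
  by move=> h1 h2; suff : e < e; [rewrite ltxx|lra].
rewrite nneseriesD//; apply: leeD; apply: Hdelta_le_cost; apply: GCE => x; by [left|right].
Qed.

(** The meshes [a] and [b] for the two sets are independent. By monotonicity both may be lowered to
    a common mesh of at most [e / 2], after which the two suprema are taken one at a time;
    finiteness makes the subtractions legitimate. *)
Lemma Hth_sepU (e : R) A B : 0 < e -> (forall x y, A x -> B y -> e <= d x y) ->
  (H A + H B <= H (A `|` B))%E.
Proof.
move=> e0 AB; have [->|Uoo] := eqVneq (H (A `|` B)) +oo%E; first by rewrite leey.
have Ufin : H (A `|` B) \is a fin_num by rewrite ge0_fin_numE ?ltey// Hth_ge0.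
have finW E : E `<=` A `|` B -> H E \is a fin_num.
  move=> EU; rewrite ge0_fin_numE ?Hth_ge0//.
  by apply: le_lt_trans (le_Hth d mu theta EU) _; rewrite -ge0_fin_numE ?Hth_ge0.
have Afin : H A \is a fin_num by apply: finW => x; left.
have Bfin : H B \is a fin_num by apply: finW => x; right.
have Hdfin a E : 0 < a -> H E \is a fin_num -> Hd a E \is a fin_num.
  move=> a0; rewrite !ge0_fin_numE ?Hth_ge0 ?Hdelta_ge0// => /(le_lt_trans _); apply.
  exact: Hdelta_le_Hth.
have HH a b : 0 < a -> 0 < b -> (Hd a A + Hd b B <= H (A `|` B))%E.
  move=> a0 b0; pose c := Num.min (Num.min a b) (e / 2).
  have c0 : 0 < c by rewrite !lt_min a0 b0 divr_gt0.
  apply: (@le_trans _ _ (Hd c A + Hd c B)%E).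
    by apply: leeD; apply: le_Hdelta; rewrite !ge_min lexx ?orbT.
  apply: le_trans (Hdelta_le_Hth _ c0); apply: (@Hdelta_sepU _ e) => //.
  by rewrite mulrC -ler_pdivlMr// ge_min lexx orbT.
rewrite -leeBrDr//; apply: ge_ereal_sup => _ [a a0 <-].
rewrite leeBrDr// addeC -leeBrDr; last exact: Hdfin.
apply: ge_ereal_sup => _ [b b0 <-].
by rewrite leeBrDr ?Hdfin// addeC HH.
Qed.

(** * Caratheodory's criterion: closed sets are measurable for a metric outer measure *)

Section closed_caratheodory.
Context (F A : set X) (cF : dclosed d F) (Aoo : (H A < +oo)%E).
(** As [F] is closed, these sets exhaust [A] minus [F]. The successive differences [ring] are
    separated from each other as soon as their indices differ by two. *)
Let far n := A `&` [set x | forall c, F c -> (2 : R) ^- n <= d x c].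
Let ring n := far n.+1 `\` far n.
Let Hfin E : E `<=` A -> H E \is a fin_num.
Proof.
move=> EA; rewrite ge0_fin_numE ?Hth_ge0//; apply: le_lt_trans Aoo.
exact: le_Hth.
Qed.
Let farA n : far n `<=` A. Proof. by move=> x []. Qed.
Let ringA n : ring n `<=` A. Proof. by move=> x [[]]. Qed.
Let nd_far i j : (i <= j)%N -> far i `<=` far j.
Proof.
move=> ij x [Ax xF]; split => // c Fc; apply: le_trans (xF c Fc).
by rewrite lef_pV2 ?posrE ?exprn_gt0// ler_eXn2l// ltr1n.
Qed.
Let pow2S n : (2 : R) ^- n = 2 * 2 ^- n.+1.
Proof. by rewrite exprS invfM mulVKf. Qed.

(** Points of [ring n.+1] are within [2^-(n+1)] of [F] and points of [far n] at least [2^-n] away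
    from it, so the two sets are [2^-(n+1)] apart. *)
Let far_ring n : (H (far n) + H (ring n.+1) <= H (far n.+2))%E.
Proof.
apply: (@le_trans _ _ (H (far n `|` ring n.+1))); last first.
  by apply: le_Hth => x [|[]//]; exact: (nd_far (leqW (leqnSn n))).
apply: (@Hth_sepU (2 ^- n.+1)); first by rewrite invr_gt0 exprn_gt0.
move=> x y [Ax xF] [[Ay _] nyF].
have [c [Fc yc]] : exists c, F c /\ d y c < 2 ^- n.+1.
  apply: contrapT => nc; apply: nyF; split => // c Fc.
  by rewrite leNgt; apply/negP => yc; apply: nc; exists c.
have := dist_tri dP x y c; have := xF c Fc; rewrite (pow2S n).
by move: yc; move: (2 ^- n.+1) => u; lra.
Qed.

Let h n : R := fine (H (far n)).
Let hE n : (h n)%:E = H (far n). Proof. by rewrite fineK// Hfin. Qed.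
Let hA n : h n <= fine (H A).
Proof. by rewrite fine_le ?Hfin// le_Hth. Qed.

Let cover_far n : A `&` ~` F `<=` far n.+1 `|` \bigcup_i ring (n + i).+1.
Proof.
move=> x [Ax nFx].
have [N xN] : exists N, far N x.
  have [rho rho0 rhoF] := cF nFx.
  have [N _ /(_ N (leqnn N)) /= Nrho] := near_infty_natSinv_lt (PosNum rho0).
  exists N; split => // c Fc; rewrite leNgt; apply/negP => xc.
  apply: (rhoF c) => //=; apply: lt_trans xc _; apply: le_lt_trans Nrho.
  by rewrite lef_pV2 ?posrE ?exprn_gt0// -natrX ler_nat ltn_expl.
have [xn|xn] := pselect (far n.+1 x); [by left|right].
have [j [xj xj1]] : exists j, ~ far (n + j).+1 x /\ far (n + j).+2 x.
  apply: contrapT => nj; suff ind j : ~ far (n + j).+1 x.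
    by apply: (ind N); apply: nd_far xN; rewrite -addSn leq_addl.
  elim: j => [|j IH]; first by rewrite addn0.
  by rewrite addnS => xj1; apply: nj; exists j.
by exists j.
Qed.

(** The ring of index [j.+1] costs at most [h j.+2 - h j]; telescoping with step two leaves two
    terms at either end. *)
Let ring_sum n N : (\sum_(0 <= i < N) H (ring (n + i).+1) <=
  (h (n + N).+1 + h (n + N) - h n.+1 - h n)%:E)%E.
Proof.
elim: N => [|N IH]; first by rewrite big_geq// addn0 lee_fin; lra.
rewrite big_nat_recr//=; apply: le_trans (leeD IH (lexx _)) _.
have := far_ring (n + N); rewrite -!hE.
rewrite -[X in (_ + X <= _)%E -> _](fineK (Hfin (@ringA (n + N).+1))).
rewrite -[X in _ -> (_ + X <= _)%E](fineK (Hfin (@ringA (n + N).+1))).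
by rewrite -!EFinD !lee_fin !addnS; lra.
Qed.

Lemma Hth_closed_split : (H (A `&` F) + H (A `&` ~` F) <= H A)%E.
Proof.
pose L := sup (range h).
have hasL : has_sup (range h).
  by split; [exists (h 0%N), 0%N|exists (fine (H A)) => _ [n _ <-]].
have hL n : h n <= L by apply: ub_le_sup; [case: hasL|exists n].
have AF : (H (A `&` F) + L%:E <= H A)%E.
  have AFfin : H (A `&` F) \is a fin_num by apply: Hfin => x [].
  rewrite -(fineK AFfin) -(fineK (Hfin (@subset_refl _ A))) -EFinD lee_fin addrC -lerBrDr.
  apply: ge_sup; [by case: hasL|move=> _ [n _ <-]].
  rewrite lerBrDr -lee_fin EFinD !fineK ?Hfin//.
  apply: (@le_trans _ _ (H (far n `|` (A `&` F)))); last by apply: le_Hth => x [[]|[]].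
  apply: (@Hth_sepU (2 ^- n)); first by rewrite invr_gt0 exprn_gt0.
  by move=> x y [Ax xF] [_ Fy]; exact: xF.
apply: le_trans AF; apply: leeD => //; apply/lee_addgt0Pr => e e0.
(* The rings beyond [n] add up to at most [2 L - h n.+1 - h n <= 2 (L - h n)], hence the choice of
   [e / 2]. *)
have [_ [n _ <-] nL] := sup_adherent (divr_gt0 e0 (ltr0n _ 2)) hasL.
apply: le_trans (le_Hth d mu theta (@cover_far n)) _.
apply: le_trans (outer_measureU2 (Hth d mu theta) _ _) _.
apply: (@le_trans _ _ (L%:E + e%:E)%E) => //.
apply: leeD; first by rewrite -[leLHS]hE lee_fin.
apply: le_trans (outer_measure_sigma_subadditive (Hth d mu theta) _) _.
apply: lime_le; first by apply: is_cvg_nneseries => i _ _; exact: Hth_ge0.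
apply: nearW => N; apply: le_trans (ring_sum n N) _; rewrite lee_fin.
have := hL (n + N).+1; have := hL (n + N)%N.
have := nd_far (leqnSn n) => /(le_Hth d mu theta); rewrite -!hE lee_fin.
by move: nL; rewrite -/L; lra.
Qed.

End closed_caratheodory.

Lemma closed_caratheodory F : dclosed d F -> caratheodory_measurable H F.
Proof.
move=> cF; apply: le_caratheodory_measurable => A.
have [Aoo|Aoo] := eqVneq (H A) +oo%E; first by rewrite [leRHS]Aoo leey.
by apply: Hth_closed_split => //; rewrite ltey.
Qed.

Lemma closed_caratheodory_restr S F : dclosed d F ->
  caratheodory_measurable (Hrestr d mu theta S) F.
Proof.
move=> cF A; rewrite /Hrestr -!(setIAC _ S); exact: closed_caratheodory.
Qed.

(** For each mesh [1/(n+1)] take an almost optimal cover. The intersection of their unions is still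
    covered by each of them, so it costs no more than [E]; it is Borel because the covering balls
    are closed. *)
Lemma Hth_hull E : (H E < +oo)%E ->
  exists B, [/\ <<s dclosed d >> B, E `<=` B & (H B <= H E)%E].
Proof.
move=> Eoo; pose a n : R := n.+1%:R^-1.
have a0 n : 0 < a n by rewrite invr_gt0.
have [G GP] : {G : nat -> nat -> option (X * R) & forall n,
    covers (fun xr : X * R => 0 < xr.2 < a n) (fun xr => cball d xr.1 xr.2) E (G n) /\
    (\sum_(i <oo) occost (Hcost d mu theta) (G n i) <= H E + (a n)%:E)%E}.
  apply: (@choice _ _ (fun n G => covers (fun xr : X * R => 0 < xr.2 < a n)
    (fun xr => cball d xr.1 xr.2) E G /\
    (\sum_(i <oo) occost (Hcost d mu theta) (G i) <= H E + (a n)%:E)%E)) => n.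
  have Hdfin : Hd (a n) E \is a fin_num.
    rewrite ge0_fin_numE ?Hdelta_ge0//; apply: le_lt_trans Eoo; exact: Hdelta_le_Hth.
  have [_ [G EG <-] Glt] := lb_ereal_inf_adherent (a0 n) Hdfin.
  exists G; split => //; apply: le_trans (ltW Glt) _.
  by apply: leeD => //; exact: Hdelta_le_Hth.
pose b := ocset (fun xr : X * R => cball d xr.1 xr.2).
exists (\bigcap_n \bigcup_i b (G n i)); split.
- have sigU (B : nat -> set X) : (forall n, <<s dclosed d >> (B n)) ->
      <<s dclosed d >> (\bigcup_n B n) by exact: sigma_algebra_bigcup.
  have sigC (B : set X) : <<s dclosed d >> B -> <<s dclosed d >> (~` B).
    by move=> sB; rewrite -setTD; exact: sigma_algebraCD.
  have -> : \bigcap_n \bigcup_i b (G n i) = ~` \bigcup_n ~` \bigcup_i b (G n i).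
    by rewrite setC_bigcup; apply: eq_bigcapr => n _; rewrite setCK.
  have sb n i : <<s dclosed d >> (b (G n i)).
    suff : dclosed d (b (G n i)) by exact: (@sub_sigma_algebra _ setT (dclosed d)).
    by rewrite /b; case: (G n i) => [xr|]/=; [exact: dclosed_cball|exact: dclosed0].
  exact: (sigC _ (sigU _ (fun n => sigC _ (sigU _ (sb n))))).
- by move=> x Ex n _; have [[_ EG] _] := GP n; exact: EG.
- apply: ge_ereal_sup => _ [c c0 <-]; apply/lee_addgt0Pr => e e0.
  have m0 : 0 < Num.min c e by rewrite lt_min c0.
  have [n _ /(_ n (leqnn n)) /=] := near_infty_natSinv_lt (PosNum m0).
  rewrite lt_min => /andP[nc ne].
  have [[aG _] Gle] := GP n.
  apply: (@le_trans _ _ (H E + (a n)%:E)%E); last by apply: leeD => //; rewrite lee_fin ltW.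
  apply: le_trans Gle; apply: Hdelta_le_cost; split; last by move=> x /(_ n I).
  move=> i; have := aG i; case: (G n i) => //= xr /andP[-> /lt_trans]; apply.
  exact: nc.
Qed.

End codim_hausdorff.

(** * Equivalence of the two seminorms *)

Lemma poweR_add_le (R : realType) (a b : \bar R) (r : R) :
  (0 <= a)%E -> (0 <= b)%E -> 0 <= r ->
  (poweR (a + b) r <= (2 `^ r)%:E * (poweR a r + poweR b r))%E.
Proof.
move=> a0 b0 r0; wlog ab : a b a0 b0 / (a <= b)%E.
  by move=> H; have [/H|/ltW/H] := leP a b; [exact|rewrite addeC (addeC (poweR a r)); exact].
apply: (@le_trans _ _ (poweR (2%:E * b) r)).
  apply: gt0_ler_poweR; rewrite ?in_itv/= ?leey ?andbT ?adde_ge0 ?mule_ge0 ?lee_fin//.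
  rewrite (_ : 2%:E = 1%:E + 1%:E)%E; last by rewrite -EFinD.
  by rewrite ge0_muleDl ?lee_fin// mul1e; apply: leeD.
rewrite poweRM ?lee_fin// poweR_EFin; apply: lee_wpmul2l; first by rewrite lee_fin powR_ge0.
by rewrite leeDr// poweR_ge0.
Qed.

Lemma nneseries_from1 (R : realType) (u : nat -> \bar R) : (forall i, 0 <= u i)%E ->
  (\sum_(1 <= i <oo) u i = \sum_(0 <= i <oo) u i.+1)%E.
Proof.
move=> u0; apply/esym/cvg_lim; first exact: ereal_hausdorff.
rewrite (_ : (fun n => _) = fun n => (\sum_(1 <= i < n.+1) u i)%E); last first.
  by apply/funext => n; rewrite big_add1.
rewrite (cvg_shiftS (fun n => \sum_(1 <= i < n) u i)%E).
by apply: is_cvg_nneseries => i _ _; exact: u0.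
Qed.

Section besov_ball.
Context (dT : measure_display) (T : measurableType dT) (R : realType) (d : T -> T -> R)
  (m : {sigma_finite_measure set T -> \bar R}) (S : set T) (Cd : R)
  (dsP : doubling_space d m S Cd) (p s : R) (p1 : 1 < p) (s0 : 0 < s).
Hypothesis reg : forall E, measurable E -> (m E < +oo)%E ->
  exists B, [/\ <<s dclosed d >> B, E `&` S `<=` B & (m B <= m E)%E].
Let k := ball_kernel d m S.
Let kP : avg_kernel m S k (Cd ^+ 2) := avg_kernel_ball dsP.
Let p0 : 0 < p. Proof. exact: lt_trans p1. Qed.
Let mS : measurable S := ker_dom kP.

(** [Emean] integrates over whole balls and the L_p norm over the whole space, whereas the kernel
    sees only [S]. *)
Lemma integral_setIS (D : set T) (g : T -> R) : measurable D ->
  measurable_fun setT g -> (forall x, 0 <= g x) ->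
  (\int[m]_(x in D) (g x)%:E = \int[m]_(x in D `&` S) (g x)%:E)%E.
Proof.
move=> mD mg g0; rewrite (@ge0_negligible_integral _ _ _ m D (~` S)).
- by rewrite setDE setCK.
- exact: measurableC.
- exact: mD.
- exact/measurable_EFinP/measurable_funTS.
- by move=> x _; rewrite lee_fin.
- exact: ds_null dsP.
Qed.

Lemma ball_kernel_int n x (g : T -> R) : S x -> measurable_fun setT g ->
  (forall y, 0 <= g y) ->
  (\int[m]_y (k n x y * g y)%:E = (m (cball d x (2 ^- n.+1)))^-1 *
    \int[m]_(y in cball d x (2 ^- n.+1) `&` S) (g y)%:E)%E.
Proof.
move=> Sx mg g0; set D := cball d x _.
have mD : measurable D by exact: (ds_meas_cball dsP).
have r01 : 0 < (2 : R) ^- n.+1 <= 1.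
  by rewrite invr_gt0 exprn_gt0//= invf_le1 ?exprn_gt0// exprn_ege1// ler1n.
have D0 := ds_gt0 dsP Sx r01; have Doo := ds_lty dsP Sx r01.
have Dfin : m D \is a fin_num by rewrite ge0_fin_numE.
have -> : ((m D)^-1 = ((fine (m D))^-1)%:E)%E.
  by rewrite -[in LHS](fineK Dfin) inver gt_eqF// fine_gt0// D0.
have mDS : measurable (D `&` S) by exact: measurableI.
rewrite -ge0_integralZl//; last 3 first.
- exact/measurable_EFinP/measurable_funTS.
- by move=> y _; rewrite lee_fin.
- by rewrite lee_fin invr_ge0 fine_ge0.
rewrite [RHS]integral_mkcond; apply: eq_integral => y _; rewrite patchE.
have [/set_mem[xy Sy]|/negP nxy] := boolP (y \in D `&` S).
  by rewrite -EFinM /k ball_kernelE.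
rewrite /k ball_kernel_out ?mul0r// => -[/= _ Sy xy].
by apply: nxy; apply/mem_set.
Qed.

Let measurable_dist (f : T -> R) c : measurable_fun setT f -> measurable_fun setT (fun y => `|f y - c|).
Proof. by move=> mf; apply: measurableT_comp => //; exact: measurable_funB. Qed.

Lemma Emean_osc n x (f : T -> R) : S x -> measurable_fun setT f ->
  Emean m f (cball d x (2 ^- n.+1)) = osc m k n f x.
Proof.
move=> Sx mf.
have r01 : 0 < (2 : R) ^- n.+1 <= 1.
  by rewrite invr_gt0 exprn_gt0//= invf_le1 ?exprn_gt0// exprn_ege1// ler1n.
rewrite /Emean (ds_gt0 dsP Sx r01) /osc; congr ereal_inf.
have mD : measurable (cball d x (2 ^- n.+1)) by exact: (ds_meas_cball dsP).
by apply/seteqP; split => _ [c _ <-]; exists c => //;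
  rewrite ball_kernel_int// -?integral_setIS//; exact: measurable_dist.
Qed.

Lemma pint_Lnorm (f : T -> R) : measurable_fun setT f ->
  'N[m]_(p%:E)[EFin \o f]%E = poweR (pint m S p f) p^-1.
Proof.
move=> mf; rewrite unlock /=; congr poweR.
transitivity (\int[m]_x (`|f x| `^ p)%:E)%E; first by apply: eq_integral.
by rewrite (integral_setIS measurableT) ?setTI//; exact: measurable_norm_powR.
Qed.

Definition besov_sum (f : T -> R) : \bar R :=
  (\sum_(1 <= i <oo) ((2 `^ (i%:R * s * p))%:E *
      \int[m]_(x in S) poweR (Emean m f (cball d x (2 ^- i))) p))%E.

Definition diff_sum (f : T -> R) : \bar R :=
  (\sum_(1 <= i <oo) ((2 `^ (i%:R * s * p))%:E *
      \int[m]_(x in S) ((m (cball d x (2 ^- i)))^-1 *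
         \int[m]_(y in cball d x (2 ^- i) `&` S) (`|f x - f y| `^ p)%:E)))%E.

Lemma besov_sumE f : measurable_fun setT f -> besov_sum f =
  (\sum_(0 <= i <oo) (2 `^ (i.+1%:R * s * p))%:E * oscp m S k p i f)%E.
Proof.
move=> mf; rewrite /besov_sum nneseries_from1; last first.
  move=> i; rewrite mule_ge0 ?lee_fin ?powR_ge0//.
  by apply: integral_ge0 => x _; exact: poweR_ge0.
apply: eq_eseriesr => i _; congr (_ * _)%E; apply: eq_integral => x /set_mem Sx.
by rewrite Emean_osc.
Qed.

Lemma diff_sumE f : measurable_fun setT f -> diff_sum f =
  (\sum_(0 <= i <oo) (2 `^ (i.+1%:R * s * p))%:E * kosc m k p i f)%E.
Proof.
move=> mf.
have mfx x : measurable_fun setT (fun y => `|f x - f y| `^ p).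
  by apply: measurable_norm_powR; exact: measurable_funB.
rewrite /diff_sum nneseries_from1; last first.
  move=> i; rewrite mule_ge0 ?lee_fin ?powR_ge0//; apply: integral_ge0 => x _.
  apply: mule_ge0; first by rewrite inve_ge0.
  by apply: integral_ge0 => y _; rewrite lee_fin powR_ge0.
apply: eq_eseriesr => i _; congr (_ * _)%E.
rewrite integral_mkcond; apply: eq_integral => x _.
rewrite patchE; case: ifPn => [/set_mem Sx|/negP nSx].
  by rewrite ball_kernel_int// => y; exact: powR_ge0.
rewrite integral0_eq// => y _; rewrite (ker_out kP) ?mul0r// => Sx.
by apply: nSx; exact/mem_set.
Qed.

Lemma besov_equiv : exists2 C : R, 1 <= C & forall f, measurable_fun setT f ->
  ('N[m]_(p%:E)[EFin \o f] < +oo)%E ->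
  (poweR (besov_sum f) p^-1 <= poweR (diff_sum f) p^-1)%E /\
  (poweR (diff_sum f) p^-1 <=
    C%:E * ('N[m]_(p%:E)[EFin \o f] + poweR (besov_sum f) p^-1))%E.
Proof.
have [K K0 KP] := kosc_series_le kP p1 s0.
have pV0 : 0 <= p^-1 by rewrite invr_ge0 ltW.
(* [K] is the constant for the p-th powers, and [2^(1/p)] comes from splitting the root of a sum;
   the [1 +] only ensures [1 <= C]. *)
set C := 1 + K `^ p^-1 * 2 `^ p^-1.
have roots (A B P : \bar R) : (0 <= P -> 0 <= A -> 0 <= B -> B <= A -> A <= K%:E * (P + B) ->
    poweR B p^-1 <= poweR A p^-1 /\ poweR A p^-1 <= C%:E * (poweR P p^-1 + poweR B p^-1))%E.
  move=> P0 A0 B0 BA APB; split.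
    by apply: gt0_ler_poweR; rewrite ?in_itv/= ?leey ?andbT.
  apply: (@le_trans _ _ (poweR (K%:E * (P + B)) p^-1)).
    by apply: gt0_ler_poweR; rewrite ?in_itv/= ?leey ?andbT// mule_ge0 ?adde_ge0.
  rewrite poweRM ?adde_ge0// poweR_EFin.
  have PB0 : (0 <= poweR P p^-1 + poweR B p^-1)%E by rewrite adde_ge0 ?poweR_ge0.
  apply: (@le_trans _ _ ((K `^ p^-1)%:E * ((2 `^ p^-1)%:E * (poweR P p^-1 + poweR B p^-1)))%E).
    by apply: lee_wpmul2l; [rewrite lee_fin powR_ge0|exact: poweR_add_le].
  by rewrite muleA -EFinM; apply: lee_wpmul2r => //; rewrite lee_fin lerDr.
exists C; first by rewrite lerDl mulr_ge0 ?powR_ge0.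
move=> f mf; rewrite pint_Lnorm; last exact: mf.
rewrite (besov_sumE mf) (diff_sumE mf) => fLoo.
have foo : (pint m S p f < +oo)%E.
  by apply: lty_poweRy fLoo; rewrite invr_eq0 gt_eqF.
have oscp0 i : (0 <= (2 `^ (i.+1%:R * s * p))%:E * oscp m S k p i f)%E.
  by apply: mule_ge0; [rewrite lee_fin powR_ge0|exact: oscp_ge0].
have kosc0 i : (0 <= (2 `^ (i.+1%:R * s * p))%:E * kosc m k p i f)%E.
  by apply: mule_ge0; [rewrite lee_fin powR_ge0|exact: (kosc_ge0 kP)].
apply: roots.
- exact: pint_ge0.
- by apply: nneseries_ge0 => i _ _; exact: kosc0.
- by apply: nneseries_ge0 => i _ _; exact: oscp0.
- apply: lee_nneseries => [i _ _|i _]; first exact: oscp0.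
  by apply: lee_wpmul2l; [rewrite lee_fin powR_ge0|exact: (oscp_le_kosc kP p1)].
- exact: (KP f mf foo (kvanish_Lp dsP p1 reg mf foo)).
Qed.

End besov_ball.

(** * Ahlfors regular sets carry a doubling measure *)

Section ADR_doubling.
Context {R : realType} {X : pointedType} (d : X -> X -> R)
  (mu : {outer_measure set X -> \bar R}) (theta : R) (S : set X).
Hypotheses (dP : is_metric d) (sepd : separable_metric d)
  (lfmu : locally_finite d mu) (fsmu : full_support d mu)
  (dbmu : unif_loc_doubling d mu) (theta0 : 0 < theta) (adrS : ADR d mu theta S).

(** Local finiteness gives one small dyadic ball of finite measure about [x]; finitely many
    doublings bring it up to radius [1]. *)
Lemma mu_cball_lty x (r : R) : r <= 1 -> (mu (cball d x r) < +oo)%E.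
Proof.
move=> r1; have [C CP] := dbmu ltr01.
suff m1 : (mu (cball d x 1) < +oo)%E.
  apply: le_lt_trans m1; apply: le_outer_measure; exact: subset_cballr.
have [e e0 eoo] := lfmu x.
have [n _ /(_ n (leqnn n)) /= ne] := near_infty_natSinv_lt (PosNum e0).
have : (mu (cball d x (2 ^- n)) < +oo)%E.
  apply: le_lt_trans eoo; apply: le_outer_measure; apply: subset_cballr => //.
  apply: le_trans (ltW ne); rewrite lef_pV2 ?posrE ?exprn_gt0//.
  by rewrite -natrX ler_nat ltn_expl.
elim: n {ne} => [|n IH]; first by rewrite expr0 invr1.
move=> noo; apply: IH.
have -> : (2 : R) ^- n = 2 * 2 ^- n.+1 by rewrite exprS invfM mulVKf.
apply: le_lt_trans (CP x (2 ^- n.+1) _ _) _.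
- by rewrite invr_gt0 exprn_gt0.
- by rewrite invf_le1 ?exprn_gt0// exprn_ege1// ler1n.
- by rewrite -[X in (_ * X)%E]fineK ?ge0_fin_numE// -EFinM ltry.
Qed.

Lemma mu_cball_gt0 x (r : R) : 0 < r -> (0 < mu (cball d x r))%E.
Proof.
move=> r0; apply: (@lt_le_trans _ _ (mu [set y | d x y < r])).
  apply: fsmu; first exact: dopen_ball.
  by exists x; rewrite /= (dist_xx dP).
by apply: le_outer_measure => y /= /ltW.
Qed.

Lemma ADR_doubling_space : exists Cd : R,
  doubling_space (T := caratheodory_type (Hrestr d mu theta S)) d (@HSm R X d mu theta S) S Cd.
Proof.
have [cS [k1 [k2 [k10 k20 kP]]]] := adrS.
have [C CP] := dbmu ltr01.
have P0 (r : R) : 0 < r -> 0 < r `^ (- theta) by move=> r0; exact: powR_gt0.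
(* Upper regularity at [2 r], doubling of [mu], [(2 r)^-theta <= r^-theta] and lower regularity at
   [r] give the quotient. The absolute value provides the sign, the maximum provides [1 <= Cd]. *)
exists (Num.max 1 (k2 * `|C| / k1)); split => //.
- by move=> F cF; exact: closed_caratheodory_restr.
- by rewrite /HSm /cmeas /= /Hrestr setICl Hth0.
- move=> x r Sx r01; apply: lt_le_trans (kP x r Sx r01).1.
  case/andP: r01 => r0 _.
  by rewrite !mule_gt0 ?lte_fin ?P0// mu_cball_gt0.
- move=> x r Sx r01; apply: le_lt_trans (kP x r Sx r01).2 _.
  case/andP: r01 => r0 r1.
  have fin : mu (cball d x r) \is a fin_num by rewrite ge0_fin_numE// mu_cball_lty.
  by rewrite -(fineK fin) -!EFinM ltry.
- by rewrite le_max lexx.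
- move=> x r Sx r0 r21.
  have r1 : r <= 1 by lra.
  have r20 : 0 < 2 * r by rewrite mulr_gt0.
  have [_ up] : _ /\ _ := kP x (2 * r) Sx (introT andP (conj r20 r21)).
  have [lo _] : _ /\ _ := kP x r Sx (introT andP (conj r0 r1)).
  have fin1 : mu (cball d x r) \is a fin_num by rewrite ge0_fin_numE// mu_cball_lty.
  have fin2 : mu (cball d x (2 * r)) \is a fin_num by rewrite ge0_fin_numE// mu_cball_lty.
  have dbl := CP x r r0 r1.
  apply: le_trans up _.
  apply: (@le_trans _ _ ((k2 * `|C| / k1)%:E * Hth d mu theta (cball d x r `&` S))%E); last first.
    by apply: lee_wpmul2r; [exact: Hth_ge0|rewrite lee_fin le_max lexx orbT].
  apply: (@le_trans _ _ ((k2 * `|C| / k1)%:E *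
      (k1%:E * (mu (cball d x r) * (r `^ (- theta))%:E)))%E); last first.
    by apply: lee_wpmul2l => //; rewrite lee_fin !mulr_ge0 ?invr_ge0// ltW.
  have u0 : 0 <= fine (mu (cball d x r)) by rewrite fine_ge0.
  have v0 : 0 <= fine (mu (cball d x (2 * r))) by rewrite fine_ge0.
  move: dbl u0 v0; rewrite -(fineK fin1) -(fineK fin2) -!EFinM !lee_fin.
  move: (fine (mu (cball d x (2 * r)))) (fine (mu (cball d x r))) => v u vu u0 v0.
  have rr : (2 * r) `^ (- theta) <= r `^ (- theta).
    rewrite !powRN lef_pV2 ?posrE ?powR_gt0//.
    by rewrite ge0_ler_powR ?nnegrE ?ltW// ltr_pMl// ltr1n.
  have -> : k2 * `|C| / k1 * (k1 * (u * r `^ (- theta))) = k2 * (`|C| * u * r `^ (- theta)).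
    by field; rewrite gt_eqF.
  rewrite ler_pM2l//; apply: ler_pM => //; first exact: powR_ge0.
  by apply: le_trans vu _; rewrite ler_wpM2r// ler_norm.
Qed.

Lemma HSm_hull (E : set X) : (Hrestr d mu theta S E < +oo)%E ->
  exists B, [/\ <<s dclosed d >> B, E `&` S `<=` B &
    (Hrestr d mu theta S B <= Hrestr d mu theta S E)%E].
Proof.
move=> Eoo; have [B [sB EB BE]] := Hth_hull dP Eoo.
by exists B; split => //; apply: le_trans BE; apply: le_Hth => x [].
Qed.

End ADR_doubling.

Theorem theorem2p3 (R : realType) (X : pointedType) (d : X -> X -> R)
  (mu : {outer_measure set X -> \bar R}) (p theta s : R) (S : set X) :
  is_metric d -> complete_metric d -> separable_metric d ->
  borel_regular d mu -> locally_finite d mu -> full_support d mu ->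
  unif_loc_doubling d mu ->
  1 < p -> poincare d mu p ->
  0 < theta -> (theta%:E < Qlow d mu)%E ->
  ADR d mu theta S ->
  0 < s ->
  (forall f : X -> R, Lp_mem d mu theta S p f ->
     (in_Besov d mu theta S s p f <-> (BNt d mu theta S s p f < +oo)%E)) /\
  exists C : R, 0 < C /\
    forall f : X -> R, Lp_mem d mu theta S p f ->
      ((C^-1)%:E * besov_norm d mu theta S s p f
         <= Lp_norm d mu theta S p f + BNt d mu theta S s p f
       /\ Lp_norm d mu theta S p f + BNt d mu theta S s p f
         <= C%:E * besov_norm d mu theta S s p f)%E.
Proof.
move=> dP _ sepd _ lfmu fsmu dbmu p1 _ theta0 _ adrS s0.
have [Cd dsP] := ADR_doubling_space dP sepd lfmu fsmu dbmu theta0 adrS.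
(* Sigma-finiteness is not built into [cmeas]; it is derived from the doubling structure of the bare
   measure and attached here. *)
pose m : {sigma_finite_measure set (caratheodory_type (Hrestr d mu theta S)) -> \bar R} :=
  HB.pack (cmeas (Hrestr d mu theta S)) (Measure_isSigmaFinite.Build _ _ _ _ (ds_sigma_finite dsP)).
have dsPm : doubling_space (T := caratheodory_type (Hrestr d mu theta S)) d m S Cd by exact: dsP.
have [C C1 CP] := besov_equiv dsPm p1 s0 (fun E _ => @HSm_hull _ _ d mu theta S dP E).
(* The [1] pays for the L_p norm, a summand of the Besov norm, and [C] for the difference seminorm.
   The opposite inequality holds with constant [1]. *)
have C10 : 0 < 1 + C by lra.
have lo f : Lp_mem d mu theta S p f ->
    (besov_norm d mu theta S s p f <= Lp_norm d mu theta S p f + BNt d mu theta S s p f)%E.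
  by move=> [mf foo]; apply: leeD => //; exact: (CP f mf foo).1.
have hi f : Lp_mem d mu theta S p f ->
    (Lp_norm d mu theta S p f + BNt d mu theta S s p f
     <= (1 + C)%:E * besov_norm d mu theta S s p f)%E.
  move=> [mf foo]; have N0 := Lnorm_ge0 (@HSm R X d mu theta S) p%:E (EFin \o f).
  have B0 : (0 <= besov_norm d mu theta S s p f)%E by rewrite adde_ge0 ?poweR_ge0.
  rewrite EFinD ge0_muleDl ?lee_fin ?(le_trans ler01 C1)// mul1e.
  apply: leeD; first by rewrite leeDl// poweR_ge0.
  exact: (CP f mf foo).2.
split; last first.
  exists (1 + C); split => // f fLp; split; last exact: hi.
  apply: le_trans (lo f fLp); rewrite -[leRHS]mul1e; apply: lee_wpmul2r.
    by rewrite adde_ge0 ?poweR_ge0// Lnorm_ge0.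
  by rewrite lee_fin invf_le1//; lra.
move=> f fLp; have [mf foo] := fLp; split => [[_ boo]|Boo].
  apply: (@le_lt_trans _ _ (Lp_norm d mu theta S p f + BNt d mu theta S s p f)%E).
    by rewrite leeDr// Lnorm_ge0.
  apply: le_lt_trans (hi f fLp) _; apply: lte_mul_pinfty => //.
  by rewrite lee_fin ltW.
split => //; apply: le_lt_trans (lo f fLp) _.
by rewrite lte_add_pinfty.
Qed.
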